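(* Let $\mathcal{P}$ be a $d$-dimensional integral polytope with Ehrhart polynomial $i(\mathcal{P},t)=1+\sum_{i=1}^{d}c_it^i$, where $c_i\neq 0$ for every $i$. Then there exist two $(d+1)$-dimensional integral polytopes $\mathcal{Q}_1$ and $\mathcal{Q}_2$ with Ehrhart polynomials $i(\mathcal{Q}_1,t)=1+\sum_{i=1}^{d+1}h_it^i$ and $i(\mathcal{Q}_2,t)=1+\sum_{i=1}^{d+1}g_it^i$ such that $\mathrm{sgn}(h_i)=\mathrm{sgn}(c_i)$ for all $1\le i\le d-1$ (in particular $\mathrm{sgn}(h_{d-1})=+1$), and $\mathrm{sgn}(g_i)=\mathrm{sgn}(c_{i-1})$ for all $2\le i\le d-1$ and $\mathrm{sgn}(g_1)=+1$.
   Context: An integral polytope is a convex polytope all of whose vertices have integer coordinates. For an integral polytope $\mathcal{P}\subseteq\mathbb{R}^N$ of dimension $d$, $i(\mathcal{P},t)=|t\mathcal{P}\cap\mathbb{Z}^N|$ ($t$ a positive integer) is a polynomial in $t$ of degree $d$ with constant term $1$, the Ehrhart polynomial. $\mathrm{sgn}(x)\in\{-1,0,+1\}$ denotes the sign of a real number $x$, with $\mathrm{sgn}(0)=0$. *)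

(* Defs.v *)
From HB Require Import structures.
From mathcomp Require Import all_boot all_order all_algebra finmap.
From mathcomp Require Import all_classical reals convex.

Set Implicit Arguments.
Unset Strict Implicit.
Unset Printing Implicit Defensive.

Import Order.TTheory GRing.Theory Num.Theory.
Local Open Scope classical_set_scope.
Local Open Scope ring_scope.

Section IntegralPolytopes.
Context {R : realType} {N : nat}.
Implicit Types P A : set 'rV[R]_N.

Definition convex_hull A : set 'rV[R]_N := smallest (@convex_set R 'rV[R]_N) A.

Definition affine_hull A : set 'rV[R]_N :=
  [set y | exists n (x : 'I_n -> 'rV[R]_N) (a : 'I_n -> R),
    [/\ forall i, A (x i), \sum_i a i = 1 & y = \sum_i a i *: x i]].

Definition is_convex_polytope P :=
  exists s : seq 'rV[R]_N, P = convex_hull [set` s].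

(* A vertex is an extreme point: it lies in no open segment joining two
   distinct points of P. *)
Definition is_vertex P (v : 'rV[R]_N) :=
  P v /\ forall (x y : 'rV[R]_N) (t : R), P x -> P y -> 0 < t < 1 ->
    v = t *: x + (1 - t) *: y -> x = y.

Definition integer_points : set 'rV[R]_N := [set v | v \is a mxOver Num.int].

Definition is_integral_polytope P :=
  is_convex_polytope P /\ is_vertex P `<=` integer_points.

(* The affine hull is a translate of the row space of B, so \rank B is its
   dimension; the empty set has no dimension. *)
Definition has_dim P (d : nat) :=
  exists (x0 : 'rV[R]_N) (B : 'M[R]_N),
    \rank B = d /\ affine_hull P = [set x | (x - x0 <= B)%MS].

Definition dilate (t : nat) P : set 'rV[R]_N := [set t%:R *: x | x in P].

(* [fset_set] is the empty set on infinite sets, a case which does not arise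
   for polytopes, as these are bounded. *)
Definition lattice_count P (t : nat) : nat :=
  #|` fset_set (dilate t P `&` integer_points)|%fset.

Definition is_ehrhart_poly P (p : {poly R}) :=
  forall t : nat, (0 < t)%N -> p.[t%:R] = (lattice_count P t)%:R.

End IntegralPolytopes.

(* Main.v *)
Require Import Defs.
From HB Require Import structures.
From mathcomp Require Import all_boot all_order all_algebra finmap.
From mathcomp Require Import all_classical interval_inference reals convex.
From mathcomp Require Import lra ring zify.

Set Implicit Arguments.
Unset Strict Implicit.
Unset Printing Implicit Defensive.

Import Order.TTheory GRing.Theory Num.Theory.
Local Open Scope classical_set_scope.
Local Open Scope ring_scope.

(** The polytope [kP x [0, a]] has Ehrhart polynomial [i(P, kt) (at + 1)], whose
    [i]-th coefficient is [k^i c_i + a k^(i-1) c_(i-1)]: take [a = 1] and [k]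
    large for [Q1], [k = 1] and [a] large for [Q2].

    It remains to see that [c_(d-1) >= 0]. Sort the lattice points of [2tP] by
    their class in [Z^N / 2 Z^N]; the class of [0] contains [i(P, t)] points.
    If [b(t)] counts those of another nonempty class then, for some [r],
    [i(P, t) <= b(t + r)] and [2 b(t + r) <= i(P, t) + i(P, t + 2r)]. Summing
    over the classes, the comparison of the coefficients of [t^d] shows that
    there are [2^d] classes, and then that of the coefficients of [t^(d-1)]
    shows [2^(d-1) c_(d-1) <= 2^d c_(d-1)].

    The second inequality is the combinatorial form of a statement on divisorial
    ideals: let [K] be the cone over [P], [x] a point of the class at height [r]
    and [n] the normal of a facet of [K]. Among the points of the class there is
    one, [s], so close to the facet that [n z < 0] forces [n (z + s) < 0] for all
    even [z]. Multiplication by the sum of the monomials with exponents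
    these [s], one per facet, maps the span of the points [y] of the class with
    [y - x] outside [K] injectively into the analogous space for the trivial
    class, [r] levels higher: a sum [y0 + s] that is extremal for [n] survives. *)

(** * Extremal elements and minimal subfamilies of finite sequences *)

Lemma seq_argmin (R : realDomainType) (T : eqType) (f : T -> R) (s : seq T) :
  s != [::] -> exists2 x, x \in s & forall y, y \in s -> f x <= f y.
Proof.
elim: s => // a s IHs _; have [->|/IHs[x xs xmin]] := eqVneq s [::].
  by exists a => [|y]; rewrite ?mem_head// inE => /eqP ->.
have [fax|/ltW fxa] := leP (f a) (f x).
  exists a => [|y]; rewrite ?mem_head// inE => /predU1P[->//|/xmin].
  exact: le_trans.
by exists x => [|y]; rewrite inE ?xs ?orbT// => /predU1P[->//|/xmin].
Qed.

(** Elements are deleted as long as [Q] survives. This serves to make a system of inequalities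
    irredundant. *)
Lemma minimal_seq (T : eqType) (Q : seq T -> Prop) (s : seq T) :
  Q s -> exists s', [/\ {subset s' <= s}, Q s' &
    forall x, x \in s' -> ~ Q (rem x s')].
Proof.
have [k] := ubnP (size s); elim: k s => // k IHk s ltsk Qs.
have [[x xs Qx]|min_s] := pselect (exists2 x, x \in s & Q (rem x s)); last first.
  by exists s; split=> // x xs Qx; apply: min_s; exists x.
have [|s' [s's Qs' mins']] := IHk (rem x s) _ Qx.
  rewrite size_rem//; case: s xs ltsk {Qs Qx} => //= a s _; lia.
by exists s'; split=> // y /s's /mem_rem.
Qed.

(** * Closure properties of integral matrices *)

Section IntegralMatrices.
Variables (R : archiRealDomainType) (m k : nat).
Implicit Types A B : 'M[R]_(m, k).

Lemma mxOver_intD A B : A \is a mxOver Num.int -> B \is a mxOver Num.int ->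
  A + B \is a mxOver Num.int.
Proof.
by move=> /mxOverP Ai /mxOverP Bi; apply/mxOverP => i j; rewrite mxE rpredD.
Qed.

Lemma mxOver_intN A : A \is a mxOver Num.int -> - A \is a mxOver Num.int.
Proof. by move=> /mxOverP Ai; apply/mxOverP => i j; rewrite mxE rpredN. Qed.

Lemma mxOver_intB A B : A \is a mxOver Num.int -> B \is a mxOver Num.int ->
  A - B \is a mxOver Num.int.
Proof. by move=> Ai Bi; apply: mxOver_intD => //; apply: mxOver_intN. Qed.

Lemma mxOver_intZ a A : a \is a Num.int -> A \is a mxOver Num.int ->
  a *: A \is a mxOver Num.int.
Proof.
by move=> ai /mxOverP Ai; apply/mxOverP => i j; rewrite mxE rpredM.
Qed.

End IntegralMatrices.

(** * Linear functionals on row vectors and sumsets *)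

Section Dot.
Variables (R : realType) (D : nat).
Implicit Types (z y : 'rV[R]_D) (n : 'cV[R]_D).

Definition dot z n : R := (z *m n) 0 0.

Lemma dotDl z y n : dot (z + y) n = dot z n + dot y n.
Proof. by rewrite /dot mulmxDl mxE. Qed.

Lemma dotNl z n : dot (- z) n = - dot z n.
Proof. by rewrite /dot mulNmx mxE. Qed.

Lemma dotBl z y n : dot (z - y) n = dot z n - dot y n.
Proof. by rewrite dotDl dotNl. Qed.

Lemma dotZl a z n : dot (a *: z) n = a * dot z n.
Proof. by rewrite /dot -scalemxAl mxE. Qed.

Lemma dot_suml (I : Type) (s : seq I) (P : pred I) (F : I -> 'rV[R]_D) n :
  dot (\sum_(i <- s | P i) F i) n = \sum_(i <- s | P i) dot (F i) n.
Proof. by rewrite /dot mulmx_suml summxE. Qed.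

Lemma dotBr z n n' : dot z (n - n') = dot z n - dot z n'.
Proof. by rewrite /dot mulmxBr mxE [in X in _ + X]mxE. Qed.

Lemma dotNr z n : dot z (- n) = - dot z n.
Proof. by rewrite /dot mulmxN mxE. Qed.

Lemma dotZr a z n : dot z (a *: n) = a * dot z n.
Proof. by rewrite /dot -scalemxAr mxE. Qed.

Lemma dot_delta z j : dot z (delta_mx j 0) = z 0 j.
Proof. by rewrite /dot -colE mxE. Qed.

Lemma dot_mul m (l : 'rV[R]_m) (V : 'M[R]_(m, D)) n :
  dot (l *m V) n = \sum_i l 0 i * dot (row i V) n.
Proof.
rewrite /dot -mulmxA mxE; apply: eq_bigr => i _.
by rewrite -row_mul !mxE.
Qed.

Lemma dot_int z n : z \is a mxOver Num.int -> n \is a mxOver Num.int ->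
  dot z n \is a Num.int.
Proof. by move=> zi ni; have /mxOverP := mxOverM zi ni; apply. Qed.

Lemma row_int m (V : 'M[R]_(m, D)) i :
  V \is a mxOver Num.int -> row i V \is a mxOver Num.int.
Proof. by move=> /mxOverP Vi; apply/mxOverP => k j; rewrite mxE. Qed.

(** The points [y0] and [s0] are lexicographically minimal for [n] followed by [fs]: a sum equal to
    [y0 + s0] must tie with it at every functional. Once [fs] contains the coordinate functionals,
    this gives [y = y0]. *)
Lemma unique_sum n (fs : seq 'cV[R]_D) (Y S : seq 'rV[R]_D) :
  Y != [::] -> S != [::] ->
  exists y0 s0, [/\ y0 \in Y, s0 \in S, forall y, y \in Y -> dot y0 n <= dot y n,
    forall s, s \in S -> dot s0 n <= dot s n &
    forall y s, y \in Y -> s \in S -> y + s = y0 + s0 ->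
      forall f, f \in n :: fs -> dot y f = dot y0 f].
Proof.
elim: fs n Y S => [|f fs IHfs] n Y S Y0 S0;
  have [y1 y1Y y1min] := seq_argmin (dot^~ n) Y0;
  have [s1 s1S s1min] := seq_argmin (dot^~ n) S0.
  exists y1, s1; split=> // y s yY sS e g; rewrite inE => /eqP ->.
  have := y1min _ yY; have := s1min _ sS; have /(congr1 (dot^~ n)) := e.
  rewrite /= !dotDl; lra.
(* Only the minimizers of [n] are kept; the later functionals break the ties among them. *)
pose Y' := [seq y <- Y | dot y n <= dot y1 n].
pose S' := [seq s <- S | dot s n <= dot s1 n].
have neq0 (T : eqType) (x : T) (s : seq T) : x \in s -> s != [::] by case: s.
have y1Y' : y1 \in Y' by rewrite mem_filter lexx.
have s1S' : s1 \in S' by rewrite mem_filter lexx.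
have [y0 [s0 []]] := IHfs f Y' S' (neq0 _ _ _ y1Y') (neq0 _ _ _ s1S').
rewrite !mem_filter => /andP[y0n y0Y] /andP[s0n s0S] _ _ u.
exists y0, s0; split=> // [y yY|s sS|y s yY sS e].
- exact: le_trans y0n (y1min _ yY).
- exact: le_trans s0n (s1min _ sS).
have ny := y1min _ yY; have ns := s1min _ sS.
have /(congr1 (dot^~ n)) := e; rewrite /= !dotDl => en.
have ny0 := y1min _ y0Y; have ns0 := s1min _ s0S.
move=> g; rewrite inE => /predU1P[->|]; first lra.
by apply: (u y s); rewrite // mem_filter ?yY ?sS andbT; lra.
Qed.

(* The matrix of the relation [w - y \in S] is row free: in a nonzero combination
   of its rows, the coefficient at a uniquely represented sum does not cancel. *)
Lemma leq_card_sumset (Y W S : {fset 'rV[R]_D}) :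
  S != fset0 ->
  (forall y, y \in Y -> exists n, forall y0 s0, y0 \in Y -> s0 \in S ->
    dot y0 n <= dot y n -> (forall s, s \in S -> dot s0 n <= dot s n) ->
    y0 + s0 \in W) ->
  (#|` Y| <= #|` W|)%N.
Proof.
move=> S0 escape; pose ys := enum_fset Y; pose ws := enum_fset W.
pose M : 'M[rat]_(size ys, size ws) :=
  \matrix_(i, j) (nth 0 ws j - nth 0 ys i \in S)%:R.
suff /eqP Mfree : row_free M.
  have := rank_leq_col M; rewrite Mfree; exact.
apply: inj_row_free => v vM; apply/eqP; apply: contraT => /rV0Pn[i vi].
pose Z := [seq nth 0 ys k | k : 'I_(size ys) <- enum 'I_(size ys) & v 0 k != 0].
have [n esc] := escape _ (mem_nth 0 (ltn_ord i)).
have Zi : nth 0 ys i \in Z by apply: map_f; rewrite mem_filter vi mem_enum.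
have Z0 : Z != [::] by case: Z Zi.
have S0' : enum_fset S != [::].
  by apply: contra S0 => /eqP S0; apply/eqP/fsetP => z; rewrite [z \in S]inE S0.
have [y0 [s0 [/mapP[k + ->] s0S y0n s0n u]]] :=
  unique_sum n [seq delta_mx j 0 | j <- enum 'I_D] Z0 S0'.
rewrite mem_filter => /andP[vk _].
have kY : nth 0 ys k \in Y by apply: mem_nth.
have wW := esc _ _ kY s0S (y0n _ Zi) s0n.
pose w : 'rV[R]_D := nth 0 ys k + s0; rewrite -/w in wW.
have wlt : (index w ws < size ws)%N by rewrite index_mem.
have /matrixP/(_ 0 (Ordinal wlt)) := vM; rewrite !mxE (bigD1 k)//= big1 => [|l lk].
  rewrite mxE /= nth_index// /w addrAC subrr add0r s0S mulr1 addr0 => vk0.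
  by rewrite vk0 eqxx in vk.
rewrite mxE /= nth_index//; 
have [->|vl] := eqVneq (v 0 l) 0; first by rewrite mul0r.
case: (boolP (_ \in S)) => [sS|_]; last by rewrite mulr0.
have lZ : nth 0 ys l \in Z by apply: map_f; rewrite mem_filter vl mem_enum.
have e := u _ _ lZ sS (subrKC _ _); case/negP: lk; apply/eqP/val_inj/eqP.
rewrite -(nth_uniq 0 (ltn_ord l) (ltn_ord k) (fset_uniq Y)); apply/eqP/rowP => j.
rewrite -!dot_delta; apply: e; rewrite in_cons; apply/orP; right.
by apply: map_f; rewrite mem_enum.
Qed.

End Dot.

(** * Finitely generated cones and their description by inequalities *)

Section Cone.
Variables (R : realType) (D : nat).
Implicit Types (z y : 'rV[R]_D) (n : 'cV[R]_D).

Definition cone m (V : 'M[R]_(m, D)) : set 'rV[R]_D :=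
  [set z | exists2 l : 'rV[R]_m, forall i, 0 <= l 0 i & z = l *m V].

Lemma cone0 m (V : 'M[R]_(m, D)) : cone V 0.
Proof. by exists 0 => [i|]; rewrite ?mxE ?mul0mx. Qed.

Lemma cone_row m (V : 'M[R]_(m, D)) i : cone V (row i V).
Proof.
by exists (delta_mx 0 i) => [j|]; rewrite ?mxE ?ler0n// rowE.
Qed.

Lemma coneD m (V : 'M[R]_(m, D)) y z : cone V y -> cone V z -> cone V (y + z).
Proof.
move=> [l l0 ->] [l' l'0 ->]; exists (l + l') => [i|]; last by rewrite mulmxDl.
by rewrite mxE addr_ge0.
Qed.

Lemma coneZ m (V : 'M[R]_(m, D)) a z : 0 <= a -> cone V z -> cone V (a *: z).
Proof.
move=> a0 [l l0 ->]; exists (a *: l) => [i|]; last by rewrite scalemxAl.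
by rewrite mxE mulr_ge0.
Qed.

Lemma cone_col_mx m (v : 'rV[R]_D) (V : 'M[R]_(m, D)) z :
  cone (col_mx v V) z <-> exists2 a, 0 <= a & cone V (z - a *: v).
Proof.
split=> [[l l0 ->]|[a a0 [l l0 e]]].
  exists (l 0 (lshift m 0)) => //; exists (rsubmx l) => [i|]; first by rewrite mxE.
  have {1}-> : l = row_mx (l 0 (lshift m 0))%:M (rsubmx l).
    by rewrite -{1}(hsubmxK l) [lsubmx l]mx11_scalar mxE.
  by rewrite mul_row_col mul_scalar_mx addrC addKr.
exists (row_mx a%:M l) => [i|].
  by case: (split_ordP i) => j ->; rewrite ?row_mxEl ?row_mxEr// ord1 mxE mulr1n.
by rewrite mul_row_col mul_scalar_mx -e addrC subrK.
Qed.

(* Fourier-Motzkin elimination of the coefficient of the first generator. *)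
Lemma cone_halfspaces m (V : 'M[R]_(m, D)) : V \is a mxOver Num.int ->
  exists F : seq 'cV[R]_D, (forall n, n \in F -> n \is a mxOver Num.int) /\
    forall z, cone V z <-> forall n, n \in F -> 0 <= dot z n.
Proof.
elim: m V => [|m IHm] V Vi.
  (* Without generators the cone is the origin, cut out by the coordinates and their opposites. *)
  exists ([seq delta_mx j 0 | j <- enum 'I_D] ++
          [seq - delta_mx j 0 | j <- enum 'I_D]).
  have di (j : 'I_D) : (delta_mx j 0 : 'cV[R]_D) \is a mxOver Num.int.
    by apply/mxOverP => k l; rewrite mxE; case: (_ && _).
  split=> [n|z].
    rewrite mem_cat => /orP[] /mapP[j _ ->]; rewrite ?di//.
    by apply/mxOverP => k l; rewrite mxE rpredN; apply/mxOverP.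
  split=> [[l _ ->] n _|z0]; first by rewrite dot_mul big_ord0.
  exists 0 => [[]//|]; apply/rowP => j; rewrite mul0mx mxE.
  apply/eqP; rewrite eq_le; apply/andP; split.
    rewrite -oppr_ge0 -(dot_delta z) -dotNr; apply: z0.
    by rewrite mem_cat; apply/orP; right; apply/mapP; exists j; rewrite ?mem_enum.
  by rewrite -(dot_delta z); apply: z0; rewrite mem_cat;
    apply/orP; left; apply/mapP; exists j; rewrite ?mem_enum.
pose v : 'rV[R]_D := usubmx (V : 'M_(1 + m, D)).
pose V' : 'M[R]_(m, D) := dsubmx (V : 'M_(1 + m, D)).
have eV : V = col_mx v V' :> 'M_(1 + m, D) by rewrite vsubmxK.
have vi : v \is a mxOver Num.int.
  by apply/mxOverP => i j; rewrite mxE; apply/mxOverP.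
have V'i : V' \is a mxOver Num.int.
  by apply/mxOverP => i j; rewrite mxE; apply/mxOverP.
have [F [Fi FP]] := IHm V' V'i.
(* Inequalities nonnegative at [v] stay valid. Each pair with opposite strict signs at [v] gives way
   to its positive combination vanishing at [v]. *)
exists ([seq n <- F | 0 <= dot v n] ++
  [seq dot v n1 *: n2 - dot v n2 *: n1 |
    n1 <- [seq n <- F | 0 < dot v n], n2 <- [seq n <- F | dot v n < 0]]).
split=> [n|z].
  rewrite mem_cat mem_filter => /orP[/andP[_]|]; first exact: Fi.
  case/allpairsP => -[n1 n2] /= []; rewrite !mem_filter.
  move=> /andP[_ /Fi n1i] /andP[_ /Fi n2i] ->.
  by apply: mxOver_intB; apply: mxOver_intZ => //; apply: dot_int.
rewrite {1}eV; split=> [/cone_col_mx[a a0 /FP zF] n|zF].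
  rewrite mem_cat mem_filter => /orP[/andP[vn nF]|].
    have := zF _ nF; rewrite dotBl dotZl subr_ge0; apply: le_trans.
    exact: mulr_ge0.
  case/allpairsP => -[n1 n2] /= []; rewrite !mem_filter.
  move=> /andP[v1 /zF z1] /andP[v2 /zF z2] ->.
  move: z1 z2; rewrite dotBr !dotZr !dotBl !dotZl => z1 z2.
  by rewrite -subr_ge0 in z1; nra.
apply/cone_col_mx.
(* For [n] negative at [v], the point [z - a *: v] satisfies [n] exactly when [a] is at least this
   quotient. The largest of these bounds and [0] is therefore the best choice of [a]. *)
pose G := [seq dot z n / dot v n | n <- F & dot v n < 0].
have [a aG amin] : exists2 a, a \in 0 :: G & forall b, b \in 0 :: G -> b <= a.
  have [|a aG amin] := @seq_argmin R _ -%R (0 :: G); first by [].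
  by exists a => // b /amin; rewrite lerN2.
exists a; first by apply: amin; rewrite mem_head.
apply/FP => n nF; rewrite dotBl dotZl subr_ge0.
have [vn|vn|vn] := ltgtP (dot v n) 0.
- rewrite -ler_ndivrMr//; apply: amin; rewrite in_cons; apply/orP; right.
  by apply: map_f; rewrite mem_filter vn.
- have z0 : 0 <= dot z n by apply: zF; rewrite mem_cat mem_filter (ltW vn) nF.
  move: aG; rewrite in_cons => /predU1P[->|/mapP[n2 + ->]]; first by rewrite mul0r.
  rewrite mem_filter => /andP[v2 n2F].
  have : 0 <= dot z (dot v n *: n2 - dot v n2 *: n).
    apply: zF; rewrite mem_cat; apply/orP; right; apply/allpairsP.
    by exists (n, n2); rewrite !mem_filter vn nF v2.
  by rewrite dotBr !dotZr => h; rewrite mulrAC ler_ndivrMr//; lra.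
- by rewrite vn mulr0; apply: zF; rewrite mem_cat mem_filter vn lexx nF.
Qed.

End Cone.

(** * Lattice points of a cone sorted by class modulo 2 and level; facets *)

Section Layers.
Variables (R : realType) (D m : nat) (V : 'M[R]_(m, D)) (lv : 'cV[R]_D).
Hypotheses (Vi : V \is a mxOver Num.int) (lvi : lv \is a mxOver Num.int).
Hypothesis lvV : forall i, dot (row i V) lv = 1.
Implicit Types (x z y : 'rV[R]_D) (n : 'cV[R]_D).

Definition evenv z := 2^-1 *: z \is a mxOver Num.int.

(** The class of [x] modulo [2 Z^D]. The level is [2 * t] so that halving identifies [layer 0 t]
    with the lattice points of the cone at level [t]. *)
Definition layer x (t : nat) : set 'rV[R]_D :=
  [set z | [/\ cone V z, z \is a mxOver Num.int, evenv (z - x) &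
    dot z lv = (2 * t)%:R]].

Lemma evenvD y z : evenv y -> evenv z -> evenv (y + z).
Proof. by move=> ey ez; rewrite /evenv scalerDr mxOver_intD. Qed.

Lemma evenvN z : evenv z -> evenv (- z).
Proof. by move=> ez; rewrite /evenv scalerN mxOver_intN. Qed.

Lemma evenvB y z : evenv y -> evenv z -> evenv (y - z).
Proof. by move=> ey ez; rewrite evenvD ?evenvN. Qed.

Lemma evenv_double z : z \is a mxOver Num.int -> evenv (2 *: z).
Proof. by move=> zi; rewrite /evenv scalerA mulVf ?scale1r ?pnatr_eq0. Qed.

Lemma evenv_int z : evenv z -> z \is a mxOver Num.int.
Proof.
move=> ez; rewrite -[z]scale1r -(@mulfV _ (2 : R)) ?pnatr_eq0// -scalerA.
exact: mxOver_intZ.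
Qed.

Lemma evenv0 : evenv 0.
Proof. by rewrite /evenv scaler0; apply/mxOverP => i j; rewrite mxE. Qed.

Lemma cone_level_ge0 z : cone V z -> 0 <= dot z lv.
Proof.
case=> l l0 ->; rewrite dot_mul; apply: sumr_ge0 => i _.
by rewrite lvV mulr1.
Qed.

Lemma layer_add x y t u z s : layer x t z -> layer y u s ->
  layer (x + y) (t + u) (z + s).
Proof.
move=> [cz zi ez lz] [cs si es ls]; split; first exact: coneD.
- exact: mxOver_intD.
- by rewrite opprD addrACA evenvD.
- by rewrite dotDl lz ls mulnDr natrD.
Qed.

Lemma layer_mod x y t : evenv (x - y) -> layer x t = layer y t.
Proof.
move=> exy; apply/seteqP; split=> z [cz zi ez lz]; split=> //.
  by rewrite -(subrK x z) -addrA evenvD.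
by rewrite -(subrK y z) -addrA evenvD// -opprB evenvN.
Qed.

Lemma layer_row i (t : nat) : layer 0 t ((2 * t)%:R *: row i V).
Proof.
split; first exact/coneZ/cone_row/ler0n.
- by apply: mxOver_intZ; rewrite ?rpred_nat ?row_int.
- by rewrite subr0 natrM -scalerA evenv_double// mxOver_intZ ?rpred_nat ?row_int.
- by rewrite dotZl lvV mulr1.
Qed.

(** All generators have level 1, so the level of a point is the sum of its coefficients; it thus
    bounds every coordinate. *)
Lemma layer_finite x t : finite_set (layer x t).
Proof.
pose M := Num.bound (\sum_i \sum_j `|V i j| : R).
pose B := (2 * t * M)%N.
(* An integer between [-B] and [B] is written as a natural number at most [2 * B], minus [B]. *)
pose f (g : {ffun 'I_D -> 'I_(2 * B).+1}) : 'rV[R]_D :=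
  \row_j ((g j)%:R - B%:R).
apply: (@sub_finite_set _ _ (range f)); last exact: finite_image.
move=> z [[l l0 zE] zi _ lz].
have suml : \sum_i l 0 i = (2 * t)%:R.
  by rewrite -lz zE dot_mul; apply: eq_bigr => i _; rewrite lvV mulr1.
have Vbound i j : `|V i j| <= M%:R.
  apply: le_trans (ltW (Num.Theory.archi_boundP _)); last first.
    by apply: sumr_ge0 => k _; apply: sumr_ge0.
  rewrite (bigD1 i)//= (bigD1 j)//= -addrA lerDl addr_ge0//.
    exact: sumr_ge0.
  by apply: sumr_ge0 => k _; apply: sumr_ge0.
have zB j : `|z 0 j| <= B%:R.
  rewrite zE mxE /B natrM -suml mulr_suml; apply: le_trans (ler_norm_sum _ _ _) _.
  by apply: ler_sum => i _; rewrite normrM (ger0_norm (l0 i)) ler_wpM2l.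
have zN j : exists2 k : nat, (k < (2 * B).+1)%N & z 0 j = k%:R - B%:R.
  have : z 0 j + B%:R \is a Num.nat.
    rewrite natrEint rpredD ?rpred_nat//=; last exact: (mxOverP zi).
    by have := zB j; rewrite ler_norml => /andP[]; lra.
  case/natrP => k e; exists k; last by rewrite -e addrK.
  have := zB j; rewrite ler_norml => /andP[_]; rewrite -[z 0 j](addrK B%:R) e.
  by rewrite lerBlDr -natrD ler_nat ltnS mul2n addnn.
exists [ffun j => Ordinal (s2valP (cid2 (zN j)))] => //.
by apply/rowP => j; rewrite !mxE ffunE /= -(s2valP' (cid2 (zN j))).
Qed.

(** The level of [s] is nonnegative, and even because those of [x] and of [s - x] are. *)
Lemma cone_level_layer x r0 s : cone V s -> evenv (s - x) ->
  x \is a mxOver Num.int -> dot x lv = (2 * r0)%:R ->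
  exists r, layer x r s.
Proof.
move=> cs es xi lx; have si : s \is a mxOver Num.int.
  by rewrite -(subrK x s); apply: mxOver_intD => //; apply: evenv_int.
have /natrP[r lr] : 2^-1 * dot s lv \is a Num.nat.
  rewrite natrEint mulr_ge0 ?invr_ge0 ?cone_level_ge0// andbT.
  rewrite -[s](subrK x) dotDl mulrDr -dotZl lx natrM mulKf ?pnatr_eq0//.
  by rewrite rpredD ?rpred_nat// dot_int.
exists r; split=> //; rewrite natrM -lr mulVKf ?pnatr_eq0//.
Qed.

(* [E] cuts out the linear span of the cone, [G] contains one functional per
   facet: the point [q] lies in the relative interior of the facet [n = 0]. *)
Definition facets (E G : seq 'cV[R]_D) :=
  [/\ forall n, n \in G -> n \is a mxOver Num.int,
      forall z n, cone V z -> n \in E -> dot z n = 0,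
      forall z n, cone V z -> n \in G -> 0 <= dot z n,
      forall z, z \is a mxOver Num.int -> (forall n, n \in E -> dot z n = 0) ->
        (forall n, n \in G -> 0 <= dot z n) -> cone V z &
      forall n, n \in G -> (exists i, dot (row i V) n = 0) /\
        exists q, [/\ q \is a mxOver Num.int, cone V q, dot q n = 0 &
          forall n', n' \in G -> n' != n -> 0 < dot q n']].

(** Among the inequalities of the cone, [E] collects those vanishing on all generators and [G] is an
    irredundant choice among the others. Two distinct generators exclude a single ray, whose only
    facet is the origin and contains no generator. *)
Lemma exists_facets (i1 i2 : 'I_m) : row i1 V != row i2 V ->
  exists E G, facets E G.
Proof.
move=> ne12; have [F [Fi FP]] := cone_halfspaces Vi.
pose vanish n := [forall i, dot (row i V) n == 0].
pose E := [seq n <- F | vanish n].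
have Enull z n : cone V z -> n \in E -> dot z n = 0.
  move=> [l _ ->]; rewrite mem_filter => /andP[/forallP vn _].
  by rewrite dot_mul big1// => i _; rewrite (eqP (vn i)) mulr0.
pose Q (G : seq 'cV[R]_D) := forall z, z \is a mxOver Num.int ->
  (forall n, n \in E -> dot z n = 0) -> (forall n, n \in G -> 0 <= dot z n) ->
  cone V z.
have [G [GF QG Gmin]] : exists G, [/\ {subset G <= [seq n <- F | ~~ vanish n]},
    Q G & forall n, n \in G -> ~ Q (rem n G)].
  apply: minimal_seq => z zi zE zG; apply/FP => n nF.
  have [vn|vn] := boolP (vanish n); last by apply: zG; rewrite mem_filter vn.
  by rewrite zE// mem_filter vn.
have Gge0 z n : cone V z -> n \in G -> 0 <= dot z n.
  by move=> /FP zF /GF; rewrite mem_filter => /andP[_ /zF].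
have Gi n : n \in G -> n \is a mxOver Num.int.
  by move=> /GF; rewrite mem_filter => /andP[_ /Fi].
exists E, G; split=> // n nG.
(* By irredundancy some integral point violates [n] and no other condition. *)
have [p [pi pE pG pn]] : exists p, [/\ p \is a mxOver Num.int,
    forall n', n' \in E -> dot p n' = 0,
    forall n', n' \in G -> n' != n -> 0 <= dot p n' & dot p n < 0].
  apply: contrapT => np; apply: (Gmin n nG) => z zi zE zG.
  have zG' n' : n' \in G -> n' != n -> 0 <= dot z n'.
    by move=> n'G nn'; apply: zG; move: n'G; rewrite (perm_mem (perm_to_rem nG));
      rewrite inE (negPf nn').
  apply: QG => // n' n'G; have [->|/zG'] := eqVneq n' n; last exact.
  by rewrite leNgt; apply/negP => zn; apply: np; exists z.
(* Both coefficients of the combination are nonnegative, since [n] is nonnegative at [y] and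
   negative at [p]; it is the point where the segment from [y] to [p] meets the facet, up to
   scaling. *)
have cross y : y \is a mxOver Num.int -> cone V y ->
    cone V (dot y n *: p - dot p n *: y).
  move=> yi cy; apply: QG => [|n' n'E|n' n'G].
  - by apply: mxOver_intB; apply: mxOver_intZ => //; apply: dot_int => //; apply: Gi.
  - by rewrite dotBl !dotZl pE// (Enull y n')// !mulr0 subr0.
  rewrite dotBl !dotZl; have [->|nn'] := eqVneq n' n.
    by rewrite mulrC subrr.
  have := pG _ n'G nn'; have := Gge0 _ _ cy nG; have := Gge0 _ _ cy n'G; nra.
split.
  (* If [n] were positive on all generators, a cone point annihilated by [n] would be [0]. The
     points given by [cross] would then make every generator a multiple of [p], and having level 1
     they would all be equal. *)
  apply: contrapT => noi.
  have ni i : dot (row i V) n != 0 by apply/eqP => ni; apply: noi; exists i.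
  have rowE i : dot (row i V) n *: p = dot p n *: row i V.
    apply/eqP; rewrite -subr_eq0; apply/eqP.
    have [||l l0 e] := cross (row i V); [exact: row_int|exact: cone_row|].
    rewrite e; suff -> : l = 0 by rewrite mul0mx.
    have : dot (l *m V) n = 0 by rewrite -e dotBl !dotZl mulrC subrr.
    rewrite dot_mul => /eqP; rewrite psumr_eq0 => [/allP l00|j _]; last first.
      by rewrite mulr_ge0// Gge0//; apply: cone_row.
    apply/rowP => j; rewrite mxE; apply/eqP.
    by have := l00 j (mem_index_enum j); rewrite /= mulf_eq0 (negPf (ni j)) orbF.
  have lvE i : dot (row i V) n * dot p lv = dot p n.
    by rewrite -dotZl rowE dotZl lvV mulr1.
  have lp : dot p lv != 0.
    by apply/eqP => lp; move: pn; rewrite -(lvE i1) lp mulr0 ltxx.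
  case/eqP: ne12; apply: (scalerI (ltr0_neq0 pn)).
  rewrite -!rowE; congr (_ *: _); apply: (mulIf lp).
  by rewrite !lvE.
(* No functional of [G] vanishes on all generators, so [c] is positive on each of them; [cross]
   carries it to an interior point of the facet. *)
pose c := \sum_i row i V.
have cc : cone V c.
  by rewrite /c; elim/big_rec: _ => [|i z _]; [apply: cone0|apply/coneD/cone_row].
have ci : c \is a mxOver Num.int.
  apply/mxOverP => i j; rewrite summxE rpred_sum// => k _.
  by apply/mxOverP/row_int.
have cpos n' : n' \in G -> 0 < dot c n'.
  move=> n'G; rewrite lt0r Gge0// andbT dot_suml psumr_eq0 => [|i _]; last first.
    by rewrite Gge0//; apply: cone_row.
  have := GF _ n'G; rewrite mem_filter => /andP[+ _]; apply: contra => /allP h.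
  by apply/forallP => i; apply: h; rewrite mem_index_enum.
exists (dot c n *: p - dot p n *: c); split; last 2 first.
- by rewrite dotBl !dotZl mulrC subrr.
- move=> n' n'G nn'; rewrite dotBl !dotZl.
  have := pG _ n'G nn'; have := cpos _ nG; have := cpos _ n'G; nra.
- by apply: mxOver_intB; apply: mxOver_intZ => //; apply: dot_int => //; apply: Gi.
- exact: cross.
Qed.

End Layers.

(** * Cardinals of finite sets, with value 0 on infinite ones *)

Definition set_card (T : choiceType) (A : set T) : nat := #|` fset_set A|%fset.

Lemma set_card_image (T U : choiceType) (f : T -> U) (A : set T) :
  injective f -> finite_set A -> set_card (f @` A) = set_card A.
Proof.
by move=> fI fA; rewrite /set_card fset_set_image// card_imfset.
Qed.

Lemma set_card_split (T : choiceType) (A C : set T) : finite_set A ->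
  set_card A = (set_card (A `&` C) + set_card (A `\` C))%N.
Proof.
move=> fA; have fI : finite_set (A `&` C) by exact: finite_setIl.
have eI : A `&` (A `&` C) = A `&` C by rewrite setIA setIid.
have eD : A `\` (A `&` C) = A `\` C by rewrite setDIr setDv set0U.
rewrite /set_card -[in RHS]eI -eD fset_setI// fset_setD//.
by rewrite cardfsID.
Qed.

(** * Comparison of a parity class with the class of the origin *)

Section SecondDifference.
Variables (R : realType) (D m : nat) (V : 'M[R]_(m, D)) (lv : 'cV[R]_D).
Hypotheses (Vi : V \is a mxOver Num.int) (lvi : lv \is a mxOver Num.int).
Hypothesis lvV : forall i, dot (row i V) lv = 1.
Variable i1 : 'I_m.
Implicit Types (x z y : 'rV[R]_D) (n : 'cV[R]_D).

Local Notation layer := (layer V lv).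

(** The points [z] with [z - a] in the cone are the translates by [a] of a lower layer; the second
    term counts the rest. *)
Lemma layer_split x y t r a : layer x r a ->
  set_card (layer y (t + r)) = (set_card (layer (y - x)%R t) +
    set_card (layer y (t + r) `\` [set z | cone V (z - a)%R]))%N.
Proof.
move=> la; have [ca ai ea lva] := la.
rewrite (@set_card_split _ (layer y (t + r)) [set z | cone V (z - a)]); last first.
  exact: (layer_finite lvV).
congr addn; rewrite -(@set_card_image _ _ _ (layer (y - x) t) (@addIr _ a));
  last exact: (layer_finite lvV).
congr set_card; apply/seteqP; split=> [z [[cz zi ez lz] cza]|_ [z lz <-]].
  exists (z - a); last by rewrite subrK.
  split=> //; first exact: mxOver_intB.
    by rewrite opprB [x - y]addrC addrACA [- a + x]addrC -[x - a]opprB evenvB.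
  by rewrite dotBl lz lva mulnDr natrD addrK.
split; last by rewrite /= addrK; case: lz.
by have := layer_add lz la; rewrite subrK.
Qed.

Variables (E G : seq 'cV[R]_D).
Hypothesis EG : facets V E G.

(* Starting from the point of [x + 2 Z^D] in the span with least nonnegative
   value of [n], we move parallel to the facet [n = 0] into the cone. *)
Lemma facet_shift n x r0 : n \in G -> layer x r0 x ->
  exists rho, forall r, (rho <= r)%N -> exists2 s, layer x r s &
    forall z, evenv z -> (forall n', n' \in E -> dot z n' = 0) ->
      dot z n < 0 -> dot (z + s) n < 0.
Proof.
have [Gi Enull Gge0 EGcone Gfacet] := EG; move=> nG [cx xi _ lx].
have [[i ni] [q [qi cq qn qpos]]] := Gfacet n nG.
pose good k := `[< exists s, [/\ evenv (s - x),
  forall n', n' \in E -> dot s n' = 0 & dot s n = k%:R] >].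
have exgood : exists k, good k.
  have /natrP[k ek] : dot x n \is a Num.nat by rewrite natrEint dot_int ?Gi ?Gge0.
  exists k; apply/asboolP; exists x; split=> // [|n' n'E]; last exact: Enull.
  by rewrite subrr evenv0.
have [k /asboolP[s0 [es0 s0E s0n]] kmin] := ex_minnP exgood.
have s0i : s0 \is a mxOver Num.int.
  by rewrite -(subrK x s0); apply: mxOver_intD => //; apply: evenv_int.
(* Adding [z] keeps the class and lowers [n]; by minimality of [k] the new value cannot be
   nonnegative. *)
have shrink z : evenv z -> (forall n', n' \in E -> dot z n' = 0) ->
    dot z n < 0 -> dot (z + s0) n < 0.
  move=> ez zE zn; rewrite ltNge; apply/negP => pos.
  have /natrP[j ej] : dot (z + s0) n \is a Num.nat.
    by rewrite natrEint pos dot_int ?Gi// mxOver_intD// evenv_int.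
  have /kmin : good j.
    apply/asboolP; exists (z + s0); split=> // [|n' n'E].
      by rewrite -addrA evenvD.
    by rewrite dotDl zE// s0E// addr0.
  by rewrite -(ler_nat R) -ej -s0n dotDl; lra.
(* The other functionals of [G] are positive integers at [q], so [K] copies of [q] outweigh their
   values at [s0]. The factor 2 preserves the class, and [n] is unchanged since it vanishes at
   [q]. *)
pose K := Num.bound (\sum_(n' <- G) `|dot s0 n'|).
pose s1 := s0 + (2 * K)%:R *: q.
have cs1 : cone V s1.
  apply: EGcone => [|n' n'E|n' n'G].
  - by rewrite mxOver_intD// mxOver_intZ ?rpred_nat.
  - by rewrite dotDl dotZl s0E// (Enull _ _ cq n'E) mulr0 addr0.
  rewrite dotDl dotZl; have [->|nn'] := eqVneq n' n.
    by rewrite qn mulr0 addr0 s0n.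
  have q1 : 1 <= dot q n'.
    have q0 := qpos _ n'G nn'; rewrite -(gtr0_norm q0) norm_intr_ge1 ?gt_eqF//.
    by rewrite dot_int ?Gi.
  have s0K : `|dot s0 n'| <= K%:R.
    apply: le_trans (ltW (Num.Theory.archi_boundP _)); last first.
      by apply: sumr_ge0.
    rewrite (perm_big _ (perm_to_rem n'G)) big_cons lerDl.
    exact: sumr_ge0.
  have K0 : 0 <= K%:R :> R by [].
  by rewrite natrM; move: s0K; rewrite ler_norml => /andP[]; nra.
have es1 : evenv (s1 - x).
  by rewrite addrAC evenvD// natrM -scalerA evenv_double// mxOver_intZ ?rpred_nat.
have [rho [_ s1i _ lv1]] := cone_level_layer lvi lvV cs1 es1 xi lx.
(* Even multiples of a generator lying on the facet raise the level without affecting [n] or the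
   class. *)
exists rho => r rho_r; exists (s1 + (2 * (r - rho))%:R *: row i V).
  have := layer_add (And4 cs1 s1i es1 lv1 : layer x rho s1)
    (layer_row Vi lvV i (r - rho)).
  by rewrite addr0 subnKC.
move=> z ez zE zn; have := shrink z ez zE zn.
by rewrite !dotDl !dotZl qn ni !mulr0 !addr0.
Qed.

(** Translation by [a] embeds [layer 0 t] into [layer x (t + r)], and the latter into
    [layer 0 (t + r + r)] because [x] and [- x] are congruent. The second inequality says that the
    complement of the first image is no larger than that of the second, which comes from
    [leq_card_sumset]. *)
Lemma second_difference x r0 : layer x r0 x -> exists r, forall t,
  (set_card (layer 0%R t) <= set_card (layer x (t + r)))%N /\
  (2 * set_card (layer x (t + r)) <=
     set_card (layer 0%R t) + set_card (layer 0%R (t + r + r)))%N.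
Proof.
have [Gi Enull Gge0 EGcone _] := EG; move=> lx.
pose shifts n s := forall z, evenv z -> (forall n', n' \in E -> dot z n' = 0) ->
  dot z n < 0 -> dot (z + s) n < 0.
have [r [a [S [la lS Sshift]]]] : exists r a (S : seq 'rV[R]_D), [/\ layer x r a,
    forall s, s \in S -> layer x r s &
    forall n, n \in G -> exists2 s, s \in S & shifts n s].
  (* All facets must share one [r]; each of them admits every large [r], so the thresholds are
     combined by a maximum. *)
  suff [rho H] : exists rho, forall r, (rho <= r)%N -> exists a (S : seq 'rV[R]_D),
      [/\ layer x r a, forall s, s \in S -> layer x r s &
      forall n, n \in G -> exists2 s, s \in S & shifts n s].
    by exists rho; apply: H.
  have : {subset G <= G} by []; elim: {1 3}G => [_|n G' IH sub].
    exists r0 => r r0r; exists (x + (2 * (r - r0))%:R *: row i1 V), [::].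
    split=> //; have := layer_add lx (layer_row Vi lvV i1 (r - r0)).
    by rewrite addr0 subnKC.
  have [|rho1 H1] := IH; first by move=> n' n'G; apply: sub; rewrite inE n'G orbT.
  have [|rho2 H2] := @facet_shift n x r0 _ lx; first by apply: sub; rewrite mem_head.
  exists (maxn rho1 rho2) => r; rewrite geq_max => /andP[r1 r2].
  have [a [S [la lS HS]]] := H1 r r1; have [s ls ss] := H2 r r2.
  exists a, (s :: S); split=> // [s'|n']; rewrite inE => /predU1P[->//|].
  - exact: lS.
  - by exists s; rewrite ?mem_head.
  - by move=> /HS[s' s'S ss']; exists s'; rewrite // inE s'S orbT.
exists r => t; have [ca ai ea lva] := la.
have xi : x \is a mxOver Num.int by case: lx.
have e1 := layer_split x t la; have e2 := layer_split 0 (t + r) la.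
rewrite subrr in e1.
rewrite sub0r (@layer_mod _ _ _ _ _ (- x) x) in e2; last first.
  by rewrite -opprD -mulr2n -scaler_nat evenvN// evenv_double.
split; first by rewrite e1 leq_addr.
suff : (set_card (layer x (t + r) `\` [set z | cone V (z - a)%R]) <=
  set_card (layer 0%R (t + r + r) `\` [set z | cone V (z - a)%R]))%N.
  move=> YW; rewrite e2 mul2n -addnn {1}e1 -[leqLHS]addnA leq_add2l addnC.
  by rewrite leq_add2l.
rewrite /set_card.
have [SS memSS] : exists SS : {fset 'rV[R]_D}, SS =i a :: S.
  by exists (seq_fset tt (a :: S)) => z; rewrite seq_fsetE.
apply: (@leq_card_sumset _ _ _ _ SS).
  by apply/fset0Pn; exists a; rewrite memSS mem_head.
have fin y u : finite_set (layer y u `\` [set z | cone V (z - a)]).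
  exact/finite_setD/(layer_finite lvV).
have Ediff y z n : cone V y -> cone V z -> n \in E -> dot (y - z) n = 0.
  by move=> cy cz nE; rewrite dotBl (Enull y n)// (Enull z n)// subrr.
move=> y; rewrite in_fset_set// inE => -[[cy yi ey ly] /= ncy].
have eya : evenv (y - a).
  by rewrite -(subrK x y) -addrA evenvD// -opprB evenvN.
have yaE n : n \in E -> dot (y - a) n = 0 by exact: Ediff.
(* As [y - a] is integral, lies in the span of the cone and is outside the cone, it violates a
   facet. *)
have [n nG yn] : exists2 n, n \in G & dot (y - a) n < 0.
  apply: contrapT => nn; apply: ncy; apply: EGcone => // [|n nG].
    exact: evenv_int.
  by rewrite leNgt; apply/negP => h; apply: nn; exists n.
have [s sS ss] := Sshift n nG.
exists n => y0 s0 y0Y; rewrite memSS inE => s0S y0n s0n.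
move: y0Y; rewrite in_fset_set// inE => -[[cy0 y0i ey0 ly0] _].
have ls0 : layer x r s0 by case/predU1P: s0S => [->//|/lS].
rewrite in_fset_set// inE; split.
  have := layer_add (And4 cy0 y0i ey0 ly0 : layer x (t + r) y0) ls0.
  by rewrite (@layer_mod _ _ _ _ _ (x + x) 0)// subr0 -mulr2n -scaler_nat evenv_double.
move=> /= cw; have := Gge0 _ _ cw nG; rewrite leNgt => /negP; apply.
have sS' : s \in SS by rewrite memSS inE sS orbT.
(* By the minimality of [y0] and [s0], the value of [n] at [y0 + s0 - a] is at most that at
   [y - a + s], which is negative. *)
apply: le_lt_trans (ss _ _ _ yn) => //.
by rewrite addrAC !dotDl !dotNl; have := s0n _ sS'; have := y0n; lra.
Qed.

End SecondDifference.

(** * Coefficients of polynomials under shifts, and their signs from growth *)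

Section PolynomialGrowth.
Variable R : realType.
Implicit Types (p q : {poly R}).

(** If [q] has degree [n], this is the sign of its leading coefficient. Were it negative, the term
    of degree [n] would outweigh all lower ones, which for [t >= 1] are at most [S] times
    [t ^+ n.-1]. *)
Lemma coef_ge0_of_eventually_ge0 q n : (size q <= n.+1)%N ->
  (exists M, forall t : nat, (M <= t)%N -> 0 <= q.[t%:R]) -> 0 <= q`_n.
Proof.
move=> sq [M qge0]; rewrite leNgt; apply/negP => qn.
pose S := \sum_(i < n) `|q`_i|.
have S0 : 0 <= S by apply: sumr_ge0.
have [t [tM t1 St]] : exists t : nat,
    [/\ (M <= t)%N, 1 <= t%:R :> R & S + q`_n * t%:R < 0].
  exists (M + (Num.bound (S / - q`_n)).+1)%N; split; first exact: leq_addr.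
    by rewrite ler1n; lia.
  have : S / - q`_n < (M + (Num.bound (S / - q`_n)).+1)%:R.
    apply: lt_le_trans (archi_boundP _) _; last by rewrite ler_nat; lia.
    by rewrite divr_ge0// oppr_ge0 ltW.
  rewrite ltr_pdivrMr ?oppr_gt0//; lra.
have := qge0 t tM; rewrite (horner_coef_wide _ sq) big_ord_recr /=.
rewrite leNgt => /negP; apply; case: n {sq} @S S0 St qn => [|n] S S0 St qn.
  by rewrite big_ord0 add0r expr0 mulr1.
apply: le_lt_trans (_ : (S + q`_n.+1 * t%:R) * t%:R ^+ n < 0); last first.
  by rewrite nmulr_rlt0// exprn_gt0// (lt_le_trans ltr01).
rewrite mulrDl -mulrA -exprS lerD2r mulr_suml; apply: ler_sum => i _.
apply: le_trans (ler_norm _) _; rewrite normrM ler_wpM2l//.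
rewrite ger0_norm ?exprn_ge0//; apply: ler_weXn2l => //.
by rewrite -ltnS.
Qed.

Lemma size_shift_sub p (a : R) :
  (size (p \Po ('X + a%:P) - p)%R <= (size p).-1)%N.
Proof.
rewrite comp_polyE -[X in _ - X](coefK p) poly_def -sumrB.
apply: leq_trans (size_sum _ _ _) _; apply/bigmax_leqP => i _.
rewrite -scalerBr subrXX addrAC subrr add0r mul_polyC.
do 2!apply: leq_trans (size_scale_leq _ _) _.
apply: leq_trans (size_sum _ _ _) _; apply/bigmax_leqP => j _.
apply: leq_trans (size_polyMleq _ _) _; rewrite size_polyXn.
have := size_poly_exp_leq ('X + a%:P) (i.-1 - j).
rewrite size_XaddC /= mul1n; move: (size (polyseq (_ ^+ _))) => s.
have bound (n k l : nat) : (k < n)%N -> (l < k)%N -> (s <= (k.-1 - l).+1)%N ->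
  ((s + l.+1).-1 <= n.-1)%N by lia.
exact: bound (ltn_ord i) (ltn_ord j).
Qed.

Lemma coef_shift p a d : (size p <= d.+1)%N -> (p \Po ('X + a%:P))`_d = p`_d.
Proof.
move=> sp; apply/eqP; rewrite -subr_eq0 -coefB; apply/eqP.
by apply/leq_sizeP: (leqnn d); apply: leq_trans (size_shift_sub _ _) _; lia.
Qed.

(** The symmetric second difference of [p] is the difference of [p - q] under a shift by [a], so it
    loses two degrees. *)
Lemma coef_shift_symm p a d : (size p <= d.+2)%N ->
  ((p \Po ('X + a%:P)) + (p \Po ('X + (- a)%:P)))`_d = 2 * p`_d.
Proof.
move=> sp; pose q := p \Po ('X + (- a)%:P).
have qa : q \Po ('X + a%:P) = p.
  by rewrite -comp_polyA comp_polyD comp_polyX comp_polyC polyCN addrK comp_polyXr.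
have sD : (size (p - q)%R <= d.+1)%N.
  by rewrite -opprB size_polyN; apply: leq_trans (size_shift_sub _ _) _; lia.
have /leq_sizeP/(_ d (leqnn d)) : (size ((p - q) \Po ('X + a%:P) - (p - q))%R <= d)%N.
  by apply: leq_trans (size_shift_sub _ _) _; lia.
rewrite comp_polyB qa !coefB => h; rewrite -/q.
by rewrite coefD; lra.
Qed.

Lemma coef_double p i : (p \Po (2 *: 'X))`_i = 2 ^+ i * p`_i.
Proof.
rewrite coef_comp_poly; have [ip|ip] := ltnP i (size p).
  rewrite (bigD1 (Ordinal ip))//= big1 => [|j ji].
    by rewrite exprZn coefZ coefXn eqxx mulr1 addr0 mulrC.
  rewrite exprZn coefZ coefXn; case: eqP => [e|]; last by rewrite !mulr0.
  by case/eqP: ji; apply: val_inj.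
rewrite (nth_default _ ip) mulr0 big1// => j _.
rewrite exprZn coefZ coefXn; case: eqP => [e|]; last by rewrite !mulr0.
by move: (ltn_ord j); rewrite -e ltnNge ip.
Qed.

End PolynomialGrowth.

(** * Parity classes of integral vectors *)

Section Classes.
Variable R : realType.

Lemma half_int (a : int) : (a%:~R / 2 : R) \is a Num.int = (2 %| a)%Z.
Proof.
apply/idP/idP => [/intrP[b e]|/dvdzP[b ->]]; last first.
  by rewrite rmorphM /= mulfK ?pnatr_eq0// intr_int.
apply/dvdzP; exists b; apply: (@intr_inj R).
by rewrite rmorphM /= -e divfK ?pnatr_eq0.
Qed.

(** The value [true] marks an even coordinate; only integral [z] matter. *)
Definition parity D (z : 'rV[R]_D) : {ffun 'I_D -> bool} :=
  [ffun j => z 0 j / 2 \is a Num.int].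

Lemma evenv_parity D (x z : 'rV[R]_D) : x \is a mxOver Num.int ->
  z \is a mxOver Num.int -> evenv (z - x) <-> parity z = parity x.
Proof.
move=> /mxOverP xi /mxOverP zi.
have h j : ((z 0 j - x 0 j) / 2 \is a Num.int) =
    ((z 0 j / 2 \is a Num.int) == (x 0 j / 2 \is a Num.int)).
  have /intrP[a ->] := zi 0 j; have /intrP[b ->] := xi 0 j.
  rewrite -rmorphB !half_int; apply/idP/eqP; lia.
split=> [/mxOverP e|/ffunP e].
  apply/ffunP => j; rewrite !ffunE; apply/eqP.
  by rewrite -h; have := e 0 j; rewrite !mxE mulrC.
apply/mxOverP => i j; rewrite !mxE mulrC ord1 h.
by have := e j; rewrite !ffunE => ->.
Qed.

Lemma set_card_partition (T : choiceType) (K : finType) (f : T -> K) (A : set T) :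
  finite_set A -> set_card A = (\sum_k set_card (A `&` [set z | f z = k]))%N.
Proof.
move=> fA; rewrite /set_card card_fset_sum1.
rewrite (partition_big f xpredT)//=; apply: eq_bigr => k _.
have -> : fset_set (A `&` [set z | f z = k]) =
    [fset z in fset_set A | f z == k]%fset.
  apply/fsetP => z; rewrite in_fset_set; last exact: finite_setIl.
  rewrite in_setI [RHS]in_fset /= inE in_fset_set//; congr andb.
  by apply/idP/eqP; rewrite inE.
by rewrite card_fset_sum1 -big_fset_condE.
Qed.

End Classes.

(** * Nonnegativity of the second coefficient for slices of a cone *)

Section SecondCoefficient.
Variables (R : realType) (D m : nat) (V : 'M[R]_(m, D)) (lv : 'cV[R]_D).
Hypotheses (Vi : V \is a mxOver Num.int) (lvi : lv \is a mxOver Num.int).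
Hypothesis lvV : forall i, dot (row i V) lv = 1.

Definition slice (s : nat) : set 'rV[R]_D :=
  [set z | [/\ cone V z, z \is a mxOver Num.int & dot z lv = s%:R]].

Lemma layer0_slice t : layer V lv 0 t = (fun z => 2 *: z) @` slice t.
Proof.
apply/seteqP; split=> [z [cz zi ez lz]|_ [z [cz zi lz] <-]].
  exists (2^-1 *: z); last by rewrite scalerA mulfV ?scale1r ?pnatr_eq0.
  split; first by apply: coneZ; rewrite ?invr_ge0.
    by rewrite subr0 in ez.
  by rewrite dotZl lz natrM mulKf ?pnatr_eq0.
split; first exact: coneZ.
- by rewrite mxOver_intZ ?rpred_nat.
- by rewrite subr0 evenv_double.
- by rewrite dotZl lz natrM.
Qed.

Lemma slice_finite t : finite_set (slice t).
Proof.
apply: (@sub_finite_set _ _ ((fun z => 2^-1 *: z) @` layer V lv 0 t)).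
  move=> z zt; exists (2 *: z); last by rewrite scalerA mulVf ?scale1r ?pnatr_eq0.
  by rewrite layer0_slice; exists z.
by apply: finite_image; apply: layer_finite.
Qed.

Lemma card_layer0 t : set_card (layer V lv 0 t) = set_card (slice t).
Proof.
rewrite layer0_slice set_card_image//; last exact: slice_finite.
by apply: scalerI; rewrite pnatr_eq0.
Qed.

Lemma slice_parity x t : x \is a mxOver Num.int ->
  slice (2 * t) `&` [set z | parity z = parity x] = layer V lv x t.
Proof.
move=> xi; apply/seteqP; split=> [z [[cz zi lz] /= pz]|z [cz zi ez lz]].
  by split=> //; apply/evenv_parity.
by split=> //; apply/(evenv_parity xi zi).
Qed.

Variables (i1 i2 : 'I_m).
Hypothesis ne12 : row i1 V != row i2 V.

(* The slice of height [2t] is the union of the [2t]-slices of the parity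
   classes; by [second_difference] each nonempty class has as many points as the
   class of [0], up to terms two degrees below the leading one. *)
Lemma second_coef_ge0 (p : {poly R}) d : (size p <= d.+2)%N -> p`_d.+1 != 0 ->
  (forall t, (0 < t)%N -> p.[t%:R] = (set_card (slice t))%:R) -> 0 <= p`_d.
Proof.
move=> sp pd1 pE.
have [E [G EG]] := exists_facets Vi lvV ne12.
pose K : finType := {ffun 'I_D -> bool}.
pose c (k : K) t := set_card (slice (2 * t) `&` [set z | parity z = k]).
pose nonempty (k : K) := `[< exists t, c k t <> 0%N >].
have c0 (k : K) t : ~~ nonempty k -> c k t = 0%N.
  move=> /asboolP nk; apply: contrapT => ck; apply: nk; by exists t.
(* For an empty class the bounds are vacuous and [r] is a dummy, which lets [choice] define it on
   all classes. Positive [t] are required because [p] counts points only there. *)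
have cbounds (k : K) : exists r : nat, nonempty k -> forall t, (0 < t)%N ->
    p.[t%:R] <= (c k (t + r)%N)%:R /\
    2 * (c k (t + r)%N)%:R <= p.[t%:R] + p.[(t + r + r)%:R].
  have [/asboolP[t0 ct0]|_] := boolP (nonempty k); last by exists 0%N.
  have [x [xS px]] : slice (2 * t0) `&` [set z | parity z = k] !=set0.
    apply/set0P; apply: contra_notN ct0 => /eqP e.
    by rewrite /c e /set_card fset_set0.
  have [cx xi lx] := xS; rewrite /= in px.
  have lay : layer V lv x t0 x by split=> //; rewrite subrr evenv0.
  have [r Hr] := second_difference Vi lvi lvV i1 EG lay.
  exists r => _ t t0'; have [] := Hr t.
  rewrite /c -px slice_parity// !card_layer0 !pE//; last by lia.
  by move=> h1 h2; split; rewrite -?natrM -?natrD ler_nat.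
have [r Hr] := choice cbounds.
pose mk := \sum_(k | nonempty k) 1 : R.
have cE t : (0 < t)%N -> p.[2 * t%:R] = \sum_(k | nonempty k) (c k t)%:R.
  move=> t0; rewrite -natrM pE ?muln_gt0//.
  rewrite (set_card_partition (@parity R D) (slice_finite _)) natr_sum.
  rewrite [RHS]big_mkcond; apply: eq_bigr => k _.
  by case: ifPn => // /c0; rewrite /c => ->.
pose M := (\sum_k r k).+1.
have rM k : (r k < M)%N by rewrite /M ltnS (bigD1 k)//= leq_addr.
pose sh a : {poly R} := p \Po ('X + a%:P).
have sh_horner a x : (sh a).[x] = p.[x + a] by rewrite horner_comp !hornerE.
have size_sh a : (size (sh a) <= d.+2)%N.
  by rewrite /sh size_comp_poly2// size_XaddC.
pose dbl : {poly R} := p \Po (2 *: 'X).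
have dbl_horner x : dbl.[x] = p.[2 * x] by rewrite horner_comp !hornerE.
have size_dbl : (size dbl <= d.+2)%N.
  by rewrite /dbl size_comp_poly2// size_scale ?size_polyX// pnatr_eq0.
(* Both inequalities are taken at [t - r k], so that every class is counted at the same [t], and
   summed over the classes: [q1] and [q2] are nonnegative for [t >= M]. *)
pose q1 := dbl - \sum_(k | nonempty k) sh (- (r k)%:R).
pose q2 := \sum_(k | nonempty k) (sh (r k)%:R + sh (- (r k)%:R)) - 2 *: dbl.
have size_sum_le (F : K -> {poly R}) : (forall k, (size (F k) <= d.+2)%N) ->
    (size (\sum_(k | nonempty k) F k)%R <= d.+2)%N.
  move=> sF; apply: leq_trans (size_sum _ _ _) _.
  by apply/bigmax_leqP => k _; apply: sF.
have sizeD (u v : {poly R}) : (size u <= d.+2)%N -> (size v <= d.+2)%N ->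
    (size (u + v)%R <= d.+2)%N.
  by move=> su sv; apply: leq_trans (size_polyD _ _) _; rewrite geq_max su.
have size1 : (size q1 <= d.+2)%N.
  by apply: sizeD; rewrite ?size_polyN ?size_dbl//; apply: size_sum_le.
have size2 : (size q2 <= d.+2)%N.
  apply/sizeD; rewrite ?size_polyN.
    by apply: size_sum_le => k; apply: sizeD.
  by apply: leq_trans (size_scale_leq _ _) _.
have sub t k : (M <= t)%N -> (0 < t - r k)%N /\ (t = (t - r k) + r k)%N.
  by move=> Mt; have := rM k; lia.
have q1ge t : (M <= t)%N -> 0 <= q1.[t%:R].
  move=> Mt; rewrite hornerE hornerN dbl_horner horner_sum cE; last exact: leq_trans Mt.
  rewrite -sumrB; apply: sumr_ge0 => k nk.
  have [t1 t2] := sub t k Mt; have [+ _] := Hr k nk _ t1.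
  rewrite -t2 sh_horner -natrB ?subr_ge0//; have := rM k; lia.
have q2ge t : (M <= t)%N -> 0 <= q2.[t%:R].
  move=> Mt; rewrite hornerE hornerN hornerZ dbl_horner horner_sum cE; last exact: leq_trans Mt.
  rewrite mulr_sumr -sumrB; apply: sumr_ge0 => k nk.
  have [t1 t2] := sub t k Mt; have [_] := Hr k nk _ t1.
  rewrite -t2 hornerD !sh_horner -natrB -?natrD; last by have := rM k; lia.
  by rewrite subr_ge0 addrC.
have q1d : q1`_d.+1 = (2 ^+ d.+1 - mk) * p`_d.+1.
  rewrite coefB coef_double coef_sum mulrBl mulr_suml; congr (_ - _).
  by apply: eq_bigr => k _; rewrite coef_shift// mul1r.
have q2d : q2`_d.+1 = 2 * (mk - 2 ^+ d.+1) * p`_d.+1.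
  rewrite coefB coefZ coef_double coef_sum.
  rewrite mulrBr mulrBl !mulrA mulr_sumr mulr_suml; congr (_ - _).
  by apply: eq_bigr => k _; rewrite coefD !coef_shift// mulr1 mulr2n mulrDl mul1r.
(* The coefficients of degree [d.+1] in [q1] and [q2] are nonnegative, yet opposite up to a factor
   2; hence both vanish. *)
have mk2 : mk = 2 ^+ d.+1.
  have := coef_ge0_of_eventually_ge0 size1 (ex_intro _ M q1ge).
  have := coef_ge0_of_eventually_ge0 size2 (ex_intro _ M q2ge).
  rewrite q1d q2d => h2 h1; apply/eqP; rewrite -subr_eq0.
  have /eqP : (mk - 2 ^+ d.+1) * p`_d.+1 = 0 by lra.
  by rewrite mulf_eq0 (negPf pd1) orbF.
have size2' : (size q2 <= d.+1)%N.
  apply/leq_sizeP => j; rewrite leq_eqVlt => /predU1P[<-|dj].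
    by rewrite q2d mk2 subrr mulr0 mul0r.
  by move/leq_sizeP: size2; apply.
have := coef_ge0_of_eventually_ge0 size2' (ex_intro _ M q2ge).
rewrite coefB coefZ coef_double coef_sum.
under eq_bigr do rewrite coef_shift_symm// -[_ * _]mul1r.
rewrite -mulr_suml -/mk mk2 exprS => h.
have : 0 < 2 ^+ d :> R by rewrite exprn_gt0.
by move: h; nra.
Qed.

End SecondCoefficient.

(** * Polytopes as hulls of finitely many points, and their vertices *)

Section Hull.
Variables (R : realType) (N : nat).
Implicit Types (P A : set 'rV[R]_N) (x y v : 'rV[R]_N).

Lemma convex_setE A : @convex_set R 'rV[R]_N A <->
  forall x y a, 0 <= a <= 1 -> A x -> A y -> A (a *: x + (1 - a) *: y).
Proof.
split=> [cA x y a /andP[a0 a1] /mem_set Ax /mem_set Ay|cA x y l /set_mem Ax /set_mem Ay].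
  exact: set_mem (cA x y (Itv01 a0 a1) Ax Ay).
apply/mem_set; have := cA x y l%:num; apply=> //.
by rewrite ge0 le1.
Qed.

Definition hull m (V : 'M[R]_(m, N)) : set 'rV[R]_N :=
  [set x | exists l : 'rV[R]_m,
    [/\ forall i, 0 <= l 0 i, \sum_i l 0 i = 1 & x = l *m V]].

Lemma hull_row m (V : 'M[R]_(m, N)) i : hull V (row i V).
Proof.
exists (delta_mx 0 i); split=> [j||]; last by rewrite rowE.
  by rewrite mxE ler0n.
rewrite (bigD1 i)//= big1 => [|j ji]; first by rewrite mxE !eqxx addr0.
by rewrite mxE (negPf ji) andbF.
Qed.

Lemma hull_convex m (V : 'M[R]_(m, N)) : @convex_set R 'rV[R]_N (hull V).
Proof.
apply/convex_setE => _ _ a /andP[a0 a1] [l [l0 l1 ->]] [k [k0 k1 ->]].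
exists (a *: l + (1 - a) *: k); split=> [i||].
- by rewrite !mxE addr_ge0// mulr_ge0// subr_ge0.
- under eq_bigr do rewrite !mxE.
  by rewrite big_split /= -!mulr_sumr l1 k1 !mulr1 addrC subrK.
- by rewrite mulmxDl -!scalemxAl.
Qed.

Lemma mulmx_row' m (l : 'rV[R]_m.+1) (V : 'M[R]_(m.+1, N)) i :
  l *m V = l 0 i *: row i V + col' i l *m row' i V.
Proof.
rewrite !mulmx_sum_row (bigD1_ord i)//=; congr (_ + _); apply: eq_bigr => j _.
by rewrite !mxE; congr (_ *: _); apply/rowP => k; rewrite !mxE.
Qed.

(** Dividing the weights other than that of [i] by their sum gives [y]. This peels off one generator
    at a time. *)
Lemma hull_split m (l : 'rV[R]_m.+1) (V : 'M[R]_(m.+1, N)) i :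
  (forall i, 0 <= l 0 i) -> \sum_i l 0 i = 1 -> l 0 i != 1 ->
  l 0 i < 1 /\ exists2 y, hull (row' i V) y &
    l *m V = l 0 i *: row i V + (1 - l 0 i) *: y.
Proof.
move=> l0 l1 li1; have sl : \sum_j l 0 (lift i j) = 1 - l 0 i.
  by rewrite -l1 (bigD1_ord i)//= addrAC subrr add0r.
have li : 0 < 1 - l 0 i.
  by rewrite lt0r subr_eq0 eq_sym li1 -sl sumr_ge0.
split; first by rewrite -subr_gt0.
exists ((1 - l 0 i)^-1 *: (col' i l *m row' i V)); last first.
  by rewrite scalerA mulfV ?gt_eqF// scale1r -mulmx_row'.
exists ((1 - l 0 i)^-1 *: col' i l); split=> [j||]; last by rewrite scalemxAl.
  by rewrite !mxE mulr_ge0// invr_ge0 ltW.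
under eq_bigr do rewrite !mxE.
by rewrite -mulr_sumr sl mulVf// gt_eqF.
Qed.

Lemma mulmx_weight1 m (l : 'rV[R]_m.+1) (V : 'M[R]_(m.+1, N)) i :
  (forall i, 0 <= l 0 i) -> \sum_i l 0 i = 1 -> l 0 i = 1 -> l *m V = row i V.
Proof.
move=> l0 l1 li; rewrite (mulmx_row' l V i) li scale1r.
suff -> : col' i l = 0 by rewrite mul0mx addr0.
have /eqP : \sum_j l 0 (lift i j) = 0.
  by apply: (addrI 1); rewrite addr0 -{1}li -l1 (bigD1_ord i).
rewrite psumr_eq0// => /allP l00; apply/rowP => j; rewrite !mxE; apply/eqP.
exact: (l00 j (mem_index_enum j)).
Qed.

Lemma hull_min m (V : 'M[R]_(m, N)) A : @convex_set R 'rV[R]_N A ->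
  (forall i, A (row i V)) -> hull V `<=` A.
Proof.
move=> cA; elim: m V => [|m IHm] V VA x [l [l0 l1 ->]].
  by move: l1; rewrite big_ord0 => /esym/eqP; rewrite oner_eq0.
have [li1|li] := eqVneq (l 0 0) 1.
  by rewrite (mulmx_weight1 V l0 l1 li1).
have [lt1 [y yH ->]] := hull_split V l0 l1 li.
move/convex_setE: cA; apply=> //; first by rewrite l0 ltW.
by apply: IHm yH => j; rewrite (_ : row j _ = row (lift 0 j) V)//;
  apply/rowP => k; rewrite !mxE.
Qed.

Lemma convex_hull_rows m (V : 'M[R]_(m, N)) :
  convex_hull (range (fun i => row i V)) = hull V.
Proof.
apply/seteqP; split; last first.
  apply: hull_min => [|i]; last by apply: sub_gen_smallest; exists i.
  move=> x y l /set_mem xH /set_mem yH; apply/mem_set => A [cA rA].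
  apply: set_mem; apply: (cA); apply/mem_set.
    exact: xH A (conj cA rA).
  exact: yH A (conj cA rA).
by apply: smallest_sub; [exact: hull_convex|move=> _ [i _ <-]; exact: hull_row].
Qed.

Lemma convex_polytope_hull P : is_convex_polytope P <->
  exists m (V : 'M[R]_(m, N)), P = hull V.
Proof.
split=> [[s ->]|[m [V ->]]].
  exists (size s), (\matrix_(i < size s) s`_i); rewrite -convex_hull_rows.
  congr convex_hull; apply/seteqP; split=> [x /= xs|_ [i _ <-]]; last first.
    by rewrite /= rowK mem_nth.
  have lt : (index x s < size s)%N by rewrite index_mem.
  by exists (Ordinal lt); rewrite ?rowK /= ?nth_index.
exists [seq row i V | i <- enum 'I_m]; rewrite -convex_hull_rows.
congr convex_hull; apply/seteqP; split=> [_ [i _ <-] /=|x /= /mapP[i _ ->]].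
  by apply: map_f; rewrite mem_enum.
by exists i.
Qed.

(** A generator of nonzero weight is either the whole combination, or the end of an open segment in
    the hull through [v]; a vertex forces that segment to collapse. *)
Lemma vertex_hull m (V : 'M[R]_(m, N)) v : is_vertex (hull V) v ->
  exists i, v = row i V.
Proof.
case=> [[l [l0 l1 vE]] vP].
have [i li] : exists i, l 0 i != 0.
  apply: contrapT => nl; have := oner_neq0 R; rewrite -l1 big1 ?eqxx// => i _.
  by apply: contrapT => /eqP li; apply: nl; exists i.
case: m V l l0 l1 vE i li vP => [|m] V l l0 l1 vE i li vP; first by case: i li.
exists i; have [l1i|l1i] := eqVneq (l 0 i) 1.
  by rewrite vE (mulmx_weight1 V l0 l1 l1i).
have [lt1 [y yH e]] := hull_split V l0 l1 l1i.
have yHV : hull V y.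
  apply: hull_min yH; first exact: hull_convex.
  move=> j; rewrite (_ : row j _ = row (lift i j) V); first exact: hull_row.
  by apply/rowP => k; rewrite !mxE.
have := vP (row i V) y (l 0 i) (hull_row V i) yHV.
rewrite lt0r li l0 lt1 vE e => /(_ isT erefl) <-.
by rewrite -scalerDl addrC subrK scale1r.
Qed.

Lemma integral_hull m (V : 'M[R]_(m, N)) : V \is a mxOver Num.int ->
  is_integral_polytope (hull V).
Proof.
move=> Vi; split; first by apply/convex_polytope_hull; exists m, V.
by move=> v /vertex_hull[i ->]; apply: row_int.
Qed.

(* In a generating family of minimal size every generator is a vertex. *)
Lemma integral_polytope_hull P : is_integral_polytope P ->
  exists m (V : 'M[R]_(m, N)), V \is a mxOver Num.int /\ P = hull V.
Proof.
case=> /convex_polytope_hull[m0 [V0 PV0]] Pint.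
pose gen m := `[< exists V : 'M[R]_(m, N), P = hull V >].
have exgen : exists m, gen m by exists m0; apply/asboolP; exists V0.
have [m /asboolP[V PV] mmin] := ex_minnP exgen.
exists m, V; split=> //; case: m V PV mmin => [|m] V PV mmin.
  exact: flatmxOver.
suff Vv i : is_vertex P (row i V).
  by apply/mxOverP => i j; have /mxOverP/(_ 0 j) := Pint _ (Vv i); rewrite mxE.
have PE : ~ hull (row' i V) (row i V).
  move=> rowH; suff /mmin : gen m by rewrite ltnn.
  apply/asboolP; exists (row' i V); rewrite PV; apply/seteqP; split.
    apply: hull_min => [|j]; first exact: hull_convex.
    have [k ->|->//] := unliftP i j.
    rewrite (_ : row _ V = row k (row' i V)); first exact: hull_row.
    by apply/rowP => u; rewrite !mxE.
  apply: hull_min => [|j]; first exact: hull_convex.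
  rewrite (_ : row j _ = row (lift i j) V); first exact: hull_row.
  by apply/rowP => k; rewrite !mxE.
split=> [|x y t]; first by rewrite PV; exact: hull_row.
rewrite PV => -[l [l0 l1 xE]] [k [k0 k1 yE]] /andP[t0 t1] vE.
pose n := t *: l + (1 - t) *: k.
have n0 j : 0 <= n 0 j by rewrite !mxE addr_ge0// mulr_ge0// ?subr_ge0 ltW.
have n1 : \sum_j n 0 j = 1.
  under eq_bigr do rewrite !mxE.
  by rewrite big_split /= -!mulr_sumr l1 k1 !mulr1 addrC subrK.
have nV : n *m V = row i V by rewrite mulmxDl -!scalemxAl -xE -yE.
have le1 (u : 'rV[R]_m.+1) : (forall j, 0 <= u 0 j) -> \sum_j u 0 j = 1 -> u 0 i <= 1.
  by move=> u0 <-; rewrite (bigD1 i)//= lerDl sumr_ge0.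
(* Weight 1 at [i] in the combination forces it in both [x] and [y], which then coincide. Otherwise
   the generator lies in the hull of the others, against minimality. *)
have [ni1|ni1] := eqVneq (n 0 i) 1.
  have li := le1 _ l0 l1; have ki := le1 _ k0 k1.
  have [l1i k1i] : l 0 i = 1 /\ k 0 i = 1 by move: ni1; rewrite !mxE; split; nra.
  by rewrite xE yE (mulmx_weight1 V l0 l1 l1i) (mulmx_weight1 V k0 k1 k1i).
have [lt1 [z zH]] := hull_split V n0 n1 ni1.
rewrite nV => rowE.
have e : (1 - n 0 i) *: row i V = (1 - n 0 i) *: z.
  by rewrite scalerBl scale1r [X in X - _]rowE addrAC subrr add0r.
case: PE; rewrite (_ : row i V = z)//.
by apply: (scalerI _ e); rewrite gt_eqF// subr_gt0.
Qed.

End Hull.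

(** * Lattice points of dilated polytopes as slices of a cone *)

Section Ehrhart.
Variables (R : realType) (N : nat).
Implicit Types (P : set 'rV[R]_N).

Section Homogenization.
Variables (m : nat) (V : 'M[R]_(m, N)).
Hypothesis Vi : V \is a mxOver Num.int.

(** The rows generate the cone over the polytope placed at height 1, and [level] reads off the
    height. *)
Definition homog : 'M[R]_(m, 1 + N) := row_mx (const_mx 1) V.
Definition level : 'cV[R]_(1 + N) := delta_mx (lshift N 0) 0.

Lemma row_mx_int (a : R) (w : 'rV[R]_N) :
  (row_mx a%:M w \is a mxOver Num.int) =
  (a \is a Num.int) && (w \is a mxOver Num.int).
Proof.
apply/mxOverP/andP => [h|[ai /mxOverP wi] i j].
  split; first by have := h 0 (lshift N 0); rewrite row_mxEl mxE eqxx.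
  by apply/mxOverP => i j; have := h i (rshift 1 j); rewrite row_mxEr.
rewrite ord1; case: (split_ordP j) => k ->; rewrite ?row_mxEl ?row_mxEr//.
by rewrite ord1 mxE eqxx.
Qed.

Lemma homog_int : homog \is a mxOver Num.int.
Proof.
apply/mxOverP => i j; rewrite /homog.
case: (split_ordP j) => k ->; rewrite ?row_mxEl ?row_mxEr; first by rewrite mxE.
exact/mxOverP.
Qed.

Lemma level_int : level \is a mxOver Num.int.
Proof. by apply/mxOverP => i j; rewrite mxE; case: (_ && _). Qed.

Lemma level_homog i : dot (row i homog) level = 1.
Proof. by rewrite dot_delta mxE row_mxEl mxE. Qed.

Lemma mul_homog (l : 'rV[R]_m) :
  l *m homog = row_mx (\sum_i l 0 i)%:M (l *m V).
Proof.
rewrite mul_mx_row; congr row_mx; apply/rowP => i.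
by rewrite ord1 !mxE eqxx mulr1n; apply: eq_bigr => j _; rewrite mxE mulr1.
Qed.

Lemma slice_homog t : (0 < t)%N ->
  slice homog level t =
  (fun w => row_mx t%:R%:M w) @` (dilate t (hull V) `&` integer_points).
Proof.
move=> t0; have tR : t%:R != 0 :> R by rewrite pnatr_eq0 -lt0n.
apply/seteqP; split=> [_ [[l l0 ->]]|_ [_ [[_ [l [l0 l1 ->]] <-] wi] <-]].
  rewrite mul_homog dot_delta row_mxEl mxE eqxx mulr1n => + lt.
  rewrite lt row_mx_int => /andP[_ wi]; exists (l *m V) => //; split=> //.
  exists (t%:R^-1 *: l *m V); last by rewrite -scalemxAl scalerA mulfV// scale1r.
  exists (t%:R^-1 *: l); split=> // [i|]; first by rewrite mxE mulr_ge0// invr_ge0.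
  by under eq_bigr do rewrite mxE; rewrite -mulr_sumr lt mulVf.
split.
- exists (t%:R *: l) => [i|]; first by rewrite mxE mulr_ge0.
  rewrite mul_homog -scalemxAl; congr row_mx; congr (_%:M).
  by under eq_bigr do rewrite mxE; rewrite -mulr_sumr l1 mulr1.
- by rewrite row_mx_int rpred_nat.
- by rewrite dot_delta row_mxEl mxE eqxx.
Qed.

Lemma dilate_hull_finite t : (0 < t)%N ->
  finite_set (dilate t (hull V) `&` integer_points).
Proof.
move=> t0; apply: (@sub_finite_set _ _ (@rsubmx R 1 1 N @` slice homog level t)).
  move=> w wt; exists (row_mx t%:R%:M w); last exact: row_mxKr.
  by rewrite slice_homog//; exists w.
apply/finite_image/slice_finite; exact: level_homog.
Qed.

Lemma card_slice_homog t : (0 < t)%N ->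
  set_card (slice homog level t) = lattice_count (hull V) t.
Proof.
move=> t0; rewrite slice_homog// set_card_image//; last exact: dilate_hull_finite.
by move=> w w' /eq_row_mx[].
Qed.

End Homogenization.

Lemma ehrhart_second_coef_ge0 P (p : {poly R}) d : is_integral_polytope P ->
  is_ehrhart_poly P p -> (size p <= d.+2)%N -> p`_d.+1 != 0 -> 0 <= p`_d.
Proof.
move=> /integral_polytope_hull[m [V [Vi ->]]] pE sp pd.
have [[i1 [i2 ne]]|eqV] :=
    pselect (exists i1 i2, row i1 (homog V) != row i2 (homog V)).
  have := second_coef_ge0 (homog_int Vi) level_int (level_homog V) ne sp pd.
  apply.
  by move=> t t0; rewrite card_slice_homog// pE.
(* When all generators coincide the count is at most 1, so [p] is bounded, contradicting its nonzero
   coefficient of positive degree [d.+1]. *)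
have count_le1 t : (0 < t)%N -> (lattice_count (hull V) t <= 1)%N.
  move=> t0; rewrite -card_slice_homog//.
  have zE z i : slice (homog V) level t z -> z = t%:R *: row i (homog V).
    case=> -[l _ ->] _; rewrite dot_mul mulmx_sum_row.
    under eq_bigr do rewrite level_homog mulr1.
    move=> <-; rewrite scaler_suml; apply: eq_bigr => j _; congr (_ *: _).
    by apply: contrapT => /eqP ne; apply: eqV; exists j, i.
  have [->|/set0P[z zt]] := eqVneq (slice (homog V) level t) set0.
    by rewrite /set_card fset_set0 cardfs0.
  have [i _] : exists i : 'I_m, True.
    apply: contrapT => none; case: (zt) => -[l _ ->] _.
    rewrite dot_mul big1 => [/esym/eqP|i _]; last by case: none; exists i.
    by rewrite pnatr_eq0 -leqn0 leqNgt t0.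
  suff -> : slice (homog V) level t = [set z].
    by rewrite /set_card fset_set1 cardfs1.
  apply/seteqP; split=> [y yt|_ ->//].
  by rewrite /= (zE y i yt) (zE z i zt).
have pge0 t : (1 <= t)%N -> 0 <= p.[t%:R] by move=> t1; rewrite pE.
have ple1 t : (1 <= t)%N -> 0 <= (1 - p).[t%:R].
  by move=> t1; rewrite !hornerE pE// subr_ge0 lern1 count_le1.
have := coef_ge0_of_eventually_ge0 sp (ex_intro _ 1%N pge0).
have s1 : (size (1 - p)%R <= d.+2)%N.
  apply: leq_trans (size_polyD _ _) _; rewrite geq_max size_poly1 size_polyN sp.
  by [].
have := coef_ge0_of_eventually_ge0 s1 (ex_intro _ 1%N ple1).
rewrite coefB coef1 /= sub0r oppr_ge0 => h1 h2.
by case/eqP: pd; apply/eqP; rewrite eq_le h1.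
Qed.

End Ehrhart.

(** * Prisms: generators, lattice points and dimension *)

Lemma set_card_setX_II (T : choiceType) (A : set T) n : finite_set A ->
  set_card (A `*` `I_n) = (set_card A * n)%N.
Proof.
move=> fA; have fX : finite_set (A `*` `I_n) by exact: finite_setX.
rewrite /set_card -{2}(size_iota 0 n) -(size_allpairs pair).
apply/perm_size/uniq_perm => [||[x i]]; first exact: fset_uniq.
  apply: allpairs_uniq; rewrite ?fset_uniq ?iota_uniq//.
  by move=> [x i] [y j] _ _ /= [-> ->].
apply/idP/allpairsP; rewrite in_fset_set// inE.
  case=> /= Ax i_n; exists (x, i); split=> //=; last by rewrite mem_iota.
  by rewrite in_fset_set// inE.
case=> -[y j] /= [+ + [-> ->]]; rewrite in_fset_set// inE mem_iota => yA jn.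
by split.
Qed.

Section Prism.
Variables (R : realType) (N : nat).
Implicit Types (P : set 'rV[R]_N) (k a t : nat).

Definition prism k a P : set 'rV[R]_(N + 1) :=
  [set z | exists x y, [/\ P x, 0 <= y <= a%:R & z = row_mx (k%:R *: x) y%:M]].

(** A point at height [y] is split between the bottom and top copies of the generators in the
    proportions [1 - y / a] and [y / a]. *)
Lemma prism_hull k a m (V : 'M[R]_(m, N)) : (0 < a)%N ->
  prism k a (hull V) = hull (col_mx (row_mx (k%:R *: V) (const_mx 0))
                                    (row_mx (k%:R *: V) (const_mx a%:R))).
Proof.
move=> a0; have aR : 0 < a%:R :> R by rewrite ltr0n.
have mulc (l : 'rV[R]_m) (b : R) :
    l *m const_mx b = (b * \sum_i l 0 i)%:M :> 'rV[R]_1.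
  apply/rowP => i; rewrite !mxE ord1 eqxx mulr1n mulr_sumr.
  by apply: eq_bigr => j _; rewrite mxE mulrC.
apply/seteqP; split=> [_ [_ [y [[l [l0 l1 ->]] /andP[y0 ya] ->]]]|_ [l [l0 l1 ->]]].
  exists (row_mx ((1 - y / a%:R) *: l) ((y / a%:R) *: l)); split=> [i||].
  - have [y1 y2] : 0 <= y / a%:R /\ y / a%:R <= 1.
      by rewrite divr_ge0// ler_pdivrMr// mul1r.
    case: (split_ordP i) => j ->; rewrite ?row_mxEl ?row_mxEr mxE mulr_ge0//.
    by rewrite subr_ge0.
  - rewrite big_split_ord /=.
    under eq_bigr do rewrite row_mxEl mxE.
    under [X in _ + X]eq_bigr do rewrite row_mxEr mxE.
    by rewrite -!mulr_sumr l1 !mulr1 subrK.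
  rewrite mul_row_col !mul_mx_row add_row_mx -!scalemxAl !mulc l1 mul0r !mulr1.
  congr row_mx; first by rewrite -scalerDl subrK scale1r scalemxAr.
  by rewrite !scale_scalar_mx mulr0 -[RHS]raddfD /= add0r divfK// gt_eqF.
rewrite -(hsubmxK l) mul_row_col !mul_mx_row add_row_mx !mulc mul0r.
exists (l *m col_mx V V), (a%:R * \sum_i (rsubmx l) 0 i); split.
- exists (lsubmx l + rsubmx l); split=> [i||].
  + by rewrite !mxE addr_ge0.
  + under eq_bigr do rewrite !mxE.
    by rewrite big_split /= -l1 big_split_ord.
  + by rewrite -{1}(hsubmxK l) mul_row_col mulmxDl.
- rewrite mulr_ge0 ?ler0n ?sumr_ge0//= => [|i _]; last by rewrite mxE.
  rewrite ler_piMr// -l1 big_split_ord /= -[leLHS]add0r lerD ?sumr_ge0//.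
  by apply: ler_sum => i _; rewrite mxE.
- congr row_mx; last by rewrite -[LHS]raddfD /= add0r.
  by rewrite -{3}(hsubmxK l) mul_row_col scalerDr !scalemxAr.
Qed.

Lemma prism_integral k a P : (0 < a)%N -> is_integral_polytope P ->
  is_integral_polytope (prism k a P).
Proof.
move=> a0 /integral_polytope_hull[m [V [Vi ->]]]; rewrite prism_hull//.
apply: integral_hull; apply/mxOverP => i j.
have kV : k%:R *: V \is a mxOver Num.int by rewrite mxOver_intZ ?rpred_nat.
case: (split_ordP i) => u ->; rewrite ?col_mxEu ?col_mxEd;
  case: (split_ordP j) => v ->; rewrite ?row_mxEl ?row_mxEr ?[const_mx _ _ _]mxE;
  by rewrite ?rpred_nat ?rpred0//; apply/mxOverP.
Qed.

(** Lattice points of the dilated prism are pairs of one in the [k * t]-th dilate of [P] and a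
    height from [0] to [a * t]. *)
Lemma prism_lattice_count k a P t : is_integral_polytope P ->
  (0 < k)%N -> (0 < a)%N -> (0 < t)%N ->
  lattice_count (prism k a P) t = (lattice_count P (k * t) * (a * t).+1)%N.
Proof.
move=> /integral_polytope_hull[m [V [Vi ->]]] k0 a0 t0.
have kt0 : (0 < k * t)%N by rewrite muln_gt0 k0.
have tR : 0 < t%:R :> R by rewrite ltr0n.
rewrite -[lattice_count (hull V) _]/(set_card _) -set_card_setX_II; last first.
  exact: dilate_hull_finite.
pose f (u : 'rV[R]_N * nat) : 'rV[R]_(N + 1) := row_mx u.1 u.2%:R%:M.
have f_inj : injective f.
  move=> [w i] [w' j] /eq_row_mx[/= -> /matrixP/(_ 0 0)]; rewrite !mxE eqxx.
  by rewrite !mulr1n => /eqP; rewrite eqr_nat => /eqP ->.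
rewrite -(set_card_image f_inj); last first.
  by apply: finite_setX => //; apply: dilate_hull_finite.
congr set_card; apply/seteqP; split.
  move=> _ [[_ [x [y [Px /andP[y0 ya] ->]] <-]]] zi.
  have [wi yi] : t%:R *: (k%:R *: x) \is a mxOver Num.int /\ t%:R * y \is a Num.int.
    split; last first.
      by have /mxOverP/(_ 0 (rshift N 0)) := zi; rewrite mxE row_mxEr mxE eqxx.
    apply/mxOverP => i j; have /mxOverP/(_ i (lshift 1 j)) := zi.
    by rewrite mxE row_mxEl [in X in _ -> X]mxE.
  have /natrP[j jE] : t%:R * y \is a Num.nat by rewrite natrEint yi mulr_ge0// ltW.
  exists (t%:R *: (k%:R *: x), j); last first.
    by rewrite /f /= scale_row_mx -jE scale_scalar_mx.
  split; last first.
    by rewrite /= ltnS -(ler_nat R) -jE natrM mulrC ler_wpM2r// ltW.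
  by split=> //; exists x => //; rewrite scalerA mulrC natrM.
move=> _ [[_ j] [[/= [x Px <-] wi] jat] <-]; rewrite /f /=; split.
  exists (row_mx (k%:R *: x) (j%:R / t%:R)%:M).
    exists x, (j%:R / t%:R); split=> //.
    by rewrite divr_ge0 ?ler0n//= ler_pdivrMr// -natrM ler_nat.
  rewrite scale_row_mx scalerA scale_scalar_mx -natrM mulnC mulrCA mulfV ?mulr1//.
  by rewrite gt_eqF.
rewrite /integer_points /=; apply/mxOverP => i u; move/mxOverP: wi => wi.
case: (split_ordP u) => v ->; rewrite ?row_mxEl ?row_mxEr; first exact: wi.
by rewrite mxE !ord1 eqxx mulr1n rpred_nat.
Qed.

Lemma prism_dim k a P d : (0 < k)%N -> (0 < a)%N -> has_dim P d ->
  has_dim (prism k a P) d.+1.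
Proof.
move=> k0 a0 [x0 [B [rB affP]]].
have kR : k%:R != 0 :> R by rewrite pnatr_eq0 -lt0n.
have aR : a%:R != 0 :> R by rewrite pnatr_eq0 -lt0n.
exists (row_mx (k%:R *: x0) 0), (block_mx B 0 0 1%:M); split.
  by rewrite rank_diag_block_mx mxrank1 rB addn1.
have subE (x : 'rV[R]_N) (y : 'rV[R]_1) :
    (row_mx x y <= block_mx B 0 0 1%:M)%MS = (x <= B)%MS.
  apply/submxP/submxP => [[D]|[D ->]].
    rewrite -(hsubmxK D) mul_row_block => /eq_row_mx[-> _].
    by exists (lsubmx D); rewrite mulmx0 addr0.
  by exists (row_mx D y); rewrite mul_row_block !mulmx0 addr0 add0r mulmx1.
apply/seteqP; split=> [_ [n [z [w [zP w1 ->]]]]|z /=].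
  have /choice[xy xyP] i : exists u : 'rV[R]_N * R,
      P u.1 /\ z i = row_mx (k%:R *: u.1) u.2%:M.
    by have [x [y [Px _ ->]]] := zP i; exists (x, y).
  have -> : \sum_i w i *: z i =
      row_mx (k%:R *: \sum_i w i *: (xy i).1) (\sum_i w i *: (xy i).2%:M).
    apply/rowP => j; rewrite summxE; case: (split_ordP j) => u ->.
      rewrite row_mxEl mxE summxE mulr_sumr; apply: eq_bigr => i _.
      by rewrite [LHS]mxE (xyP i).2 row_mxEl !mxE mulrCA.
    rewrite row_mxEr summxE; apply: eq_bigr => i _.
    by rewrite [LHS]mxE (xyP i).2 row_mxEr !mxE.
  rewrite /= opp_row_mx add_row_mx subE -scalerBr scalemx_sub//.
  have : affine_hull P (\sum_i w i *: (xy i).1).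
    by exists n, (fun i => (xy i).1), w; split=> // i; have [] := xyP i.
  by rewrite affP.
rewrite -(hsubmxK z) opp_row_mx add_row_mx subE => zB.
set x := lsubmx z in zB *; set y := rsubmx z.
have : affine_hull P (k%:R^-1 *: x).
  rewrite affP /=; have -> : k%:R^-1 *: x - x0 = k%:R^-1 *: (x - k%:R *: x0).
    by rewrite scalerBr scalerA mulVf// scale1r.
  exact: scalemx_sub.
case=> n [p [w [pP w1 xE]]].
(* Each point [p i] is used at heights [0] and [a], with weights [w i * (1 - b)] and [w i * b].
   Affine weights may be negative, so [y] is unrestricted. *)
pose b := y 0 0 / a%:R.
exists (n + n)%N, (fun j : 'I_(n + n) => match fintype.split j with
  | inl i => row_mx (k%:R *: p i) 0 | inr i => row_mx (k%:R *: p i) a%:R%:M end),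
  (fun j : 'I_(n + n) => match fintype.split j with
  | inl i => w i * (1 - b) | inr i => w i * b end).
split=> [j||].
- case: (fintype.split j) => i; first by exists (p i), 0; rewrite lexx ler0n raddf0.
  by exists (p i), a%:R; rewrite lexx ler0n.
- rewrite big_split_ord /=.
  under eq_bigr do rewrite (unsplitK (inl _)).
  under [X in _ + X]eq_bigr do rewrite (unsplitK (inr _)).
  by rewrite -!mulr_suml w1 !mul1r subrK.
rewrite big_split_ord /=.
under eq_bigr do rewrite (unsplitK (inl _)).
under [X in _ + X]eq_bigr do rewrite (unsplitK (inr _)).
have -> : x = k%:R *: \sum_i w i *: p i by rewrite -xE scalerA mulfV ?scale1r.
have -> : y = (\sum_i w i * b * a%:R)%:M.
  by rewrite -!mulr_suml w1 mul1r divfK// -mx11_scalar.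
apply/rowP => j; rewrite [RHS]mxE !summxE; case: (split_ordP j) => u ->.
  rewrite row_mxEl mxE summxE mulr_sumr -big_split /=; apply: eq_bigr => i _.
  by rewrite ![(_ *: row_mx _ _) _ _]mxE !row_mxEl !mxE; ring.
rewrite row_mxEr -big_split mxE ord1 eqxx mulr1n /=; apply: eq_bigr => i _.
by rewrite ![(_ *: row_mx _ _) _ _]mxE !row_mxEr !mxE eqxx mulr1n; ring.
Qed.

End Prism.

(** * Ehrhart coefficients of prisms and their signs *)

Lemma sgrD_dominant (R : realDomainType) (u v : R) : `|v| < `|u| ->
  Num.sg (u + v) = Num.sg u.
Proof.
have [u0|u0|->] := ltgtP u 0; last by rewrite normr0 normr_lt0.
  by rewrite (ltr0_norm u0) ltr_norml => /andP[_ h]; rewrite !ltr0_sg//; lra.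
by rewrite (gtr0_norm u0) ltr_norml => /andP[h _]; rewrite !gtr0_sg//; lra.
Qed.

(** The integer exceeds the sum of all the ratios, hence each of them. *)
Lemma exists_dominating_nat (R : archiRealFieldType) (u v : nat -> R) n :
  (forall i, (i < n)%N -> u i != 0) ->
  exists2 k : nat, (0 < k)%N & forall i, (i < n)%N -> `|v i| < `|k%:R * u i|.
Proof.
move=> u0; pose S := \sum_(i < n) `|v i| / `|u i|.
have S0 : 0 <= S by apply: sumr_ge0 => i _; rewrite divr_ge0.
exists (Num.bound S).+1 => // i lt_in; have ui : 0 < `|u i| by rewrite normr_gt0 u0.
rewrite normrM ger0_norm ?ler0n// -ltr_pdivrMr//.
apply: (@le_lt_trans _ _ S).
  rewrite /S (bigD1 (Ordinal lt_in))//= lerDl.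
  by apply: sumr_ge0 => j _; rewrite divr_ge0.
by apply: lt_le_trans (archi_boundP S0) _; rewrite ler_nat.
Qed.

Section PrismEhrhart.
Variables (R : realType) (N d : nat) (P : set 'rV[R]_N) (c : nat -> R).
Hypothesis intP : is_integral_polytope P.
Hypothesis ehrP : is_ehrhart_poly P (1 + \sum_(1 <= i < d.+1) c i *: 'X^i).

(** The constant term 1 and zeros above degree [d] are built in, whatever values [c] takes there. *)
Definition ext_coef (i : nat) : R :=
  if i == 0%N then 1 else if (i <= d)%N then c i else 0.

(** For [i >= 1], the coefficient of [t^i] in [i(P, kt) (at + 1)]. *)
Definition prism_coef (k a i : nat) : R :=
  k%:R ^+ i * ext_coef i + a%:R * (k%:R ^+ i.-1 * ext_coef i.-1).

Lemma ehrhart_polyE :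
  1 + \sum_(1 <= i < d.+1) c i *: 'X^i = \poly_(i < d.+1) ext_coef i.
Proof.
rewrite poly_def big_ord_recl /= scale1r expr0; congr (_ + _).
rewrite big_add1 big_mkord; apply: eq_bigr => i _.
by rewrite /ext_coef /bump /= add1n ltn_ord.
Qed.

Lemma prism_ehrhart k a : (0 < k)%N -> (0 < a)%N ->
  is_ehrhart_poly (prism k a P)
    (1 + \sum_(1 <= i < d.+2) prism_coef k a i *: 'X^i).
Proof.
move=> k0 a0 t t0; apply/esym; rewrite prism_lattice_count// natrM -ehrP ?muln_gt0 ?k0//.
rewrite ehrhart_polyE horner_poly -[(a * t).+1]addn1 natrD mulrDr mulr1 [LHS]addrC.
rewrite [RHS]hornerD hornerC horner_sum big_add1 big_mkord /=.
under [in RHS]eq_bigr do rewrite hornerZ hornerXn /prism_coef mulrDl.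
rewrite big_split /= addrA; congr (_ + _).
  rewrite [in RHS]big_ord_recr /= [ext_coef d.+1]/ext_coef /= ltnn mulr0 mul0r addr0.
  rewrite [in LHS]big_ord_recl /= [ext_coef 0]/ext_coef /= expr0 mulr1; congr (_ + _).
  by apply: eq_bigr => i _; rewrite /bump /= add1n natrM exprMn; ring.
rewrite mulr_suml; apply: eq_bigr => i _; rewrite !natrM exprMn exprS; ring.
Qed.

End PrismEhrhart.

Theorem theorem5p1 (R : realType) (N d : nat) (P : set 'rV[R]_N) (c : nat -> R)
    (intP : is_integral_polytope P) (dimP : has_dim P d)
    (ehrP : is_ehrhart_poly P (1 + \sum_(1 <= i < d.+1) c i *: 'X^i))
    (c_neq0 : forall i, (1 <= i <= d)%N -> c i != 0) :
  exists (N1 N2 : nat) (Q1 : set 'rV[R]_N1) (Q2 : set 'rV[R]_N2)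
         (h g : nat -> R),
    [/\ is_integral_polytope Q1 /\ has_dim Q1 d.+1,
        is_integral_polytope Q2 /\ has_dim Q2 d.+1,
        is_ehrhart_poly Q1 (1 + \sum_(1 <= i < d.+2) h i *: 'X^i) /\
        is_ehrhart_poly Q2 (1 + \sum_(1 <= i < d.+2) g i *: 'X^i),
        (forall i, (1 <= i <= d.-1)%N -> Num.sg (h i) = Num.sg (c i)) /\
        ((2 <= d)%N -> Num.sg (h d.-1) = 1) &
        (forall i, (2 <= i <= d.-1)%N -> Num.sg (g i) = Num.sg (c i.-1)) /\
        Num.sg (g 1%N) = 1].
Proof.
pose e := ext_coef d c.
have eE i : (1 <= i <= d)%N -> e i = c i.
  by case: i => // i /andP[_ id]; rewrite /e /ext_coef /= id.
have e_neq0 i : (i < d.+1)%N -> e i != 0.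
  by case: i => [|i] id; [exact: oner_neq0|rewrite eE ?c_neq0].
(* Nonnegativity holds because [c d] is a nonzero leading coefficient; strictness is the hypothesis
   on [c d.-1]. *)
have c_gt0 : (2 <= d)%N -> 0 < c d.-1.
  case: d dimP ehrP c_neq0 {e eE e_neq0} => [|[|n]]// _ ehrP' c_neq0' _ /=.
  rewrite lt0r c_neq0' ?leqnSn//=.
  have := ehrhart_second_coef_ge0 (d := n.+1) intP ehrP'.
  rewrite ehrhart_polyE size_poly !coef_poly !ltnSn leqnSn /ext_coef /=.
  by rewrite ltnSn leqnSn => -> //; apply: c_neq0'; rewrite leqnn.
(* The choice of [k] rests on [k^i e_i + k^(i-1) e_(i-1) = k^(i-1) (k e_i + e_(i-1))]; that of [a]
   on the coefficient [e_(i+1) + a e_i] of degree [i + 1]. *)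
have [k k0 kP] := @exists_dominating_nat R e (fun i => e i.-1) d.+1 e_neq0.
have [a a0 aP] := @exists_dominating_nat R e (fun i => e i.+1) d.+1 e_neq0.
have sg_nat (n : nat) : (0 < n)%N -> Num.sg (n%:R : R) = 1.
  by move=> n0; rewrite gtr0_sg ?ltr0n.
have sg_h i : (1 <= i <= d)%N -> Num.sg (prism_coef d c k 1 i) = Num.sg (c i).
  case: i => // i id; have /kP := (andP id).2 : (i.+1 < d.+1)%N.
  move=> /sgrD_dominant; rewrite -(eE _ id) sgrM sg_nat// mul1r => <-.
  by rewrite /prism_coef mulr1n mul1r /= exprSr -mulrA -mulrDr sgrM sgrX sg_nat//
    expr1n mul1r.
have sg_g i : (i <= d)%N -> Num.sg (prism_coef d c 1 a i.+1) = Num.sg (e i).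
  move=> id; have /sgrD_dominant := aP i id; rewrite sgrM sg_nat// mul1r => <-.
  by rewrite /prism_coef mulr1n !expr1n !mul1r addrC.
exists (N + 1)%N, (N + 1)%N, (prism k 1 P), (prism 1 a P),
  (prism_coef d c k 1), (prism_coef d c 1 a); split.
- by split; [exact: prism_integral|exact: prism_dim].
- by split; [exact: prism_integral|exact: prism_dim].
- by split; exact: prism_ehrhart.
- split=> [i /andP[i1 id]|d2].
    by apply: sg_h; rewrite i1 (leq_trans id)// leq_pred.
  by rewrite sg_h ?gtr0_sg ?c_gt0// leq_pred andbT -ltnS prednK// ltnW.
- split=> [[|i]// /andP[i1 id]|].
    rewrite sg_g; last by apply: leq_trans (leq_trans id (leq_pred _)).
    by rewrite eE//= -ltnS i1 /= (leq_trans (leqnSn i))// (leq_trans id)// leq_pred.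
  by rewrite sg_g// gtr0_sg.
Qed.
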